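(* Let $F:\mathbb{R}^d\to\mathbb{R}^d$ be monotone and $L$-Lipschitz, accessed through a stochastic oracle $\widehat F$ with parameters $\sigma$ and $L$ as described in the context, and let $\mathbf{u}^*$ satisfy $F(\mathbf{u}^* )=\mathbf{0}$. Given an arbitrary $\mathbf{u}_0\in\mathbb{R}^d$, $\epsilon>0$ and $0<\eta_0\le\frac1{3\sqrt3L}$, let the iterates $\mathbf{u}_k$, $\mathbf{v}_{k-1}$ ($k\ge1$) evolve according to Algorithm 2 (described in the context), with $M=9L^2$ and $\underline\eta=\frac{\eta_0(1-2M\eta_0^2)}{1-M\eta_0^2}$. Then for all $k\ge2$, $$\mathbb{E}\big[\|F(\mathbf{u}_k)\|^2+2L^2\|\mathbf{u}_k-\mathbf{v}_{k-1}\|^2\big]\le\frac{\Lambda_0}{(k+1)(k+2)}+\Lambda_1\epsilon^2,$$ where $\Lambda_0=\frac{4(L^2\eta_0\underline\eta+1)\|\mathbf{u}_0-\mathbf{u}^*\|^2}{\underline\eta^2}$ and $\Lambda_1=\frac{5(1+M\underline\eta\eta_0)}{M\underline\eta^2}$. In particular, $\mathbb{E}\big[\|F(\mathbf{u}_N)\|^2+2L^2\|\mathbf{u}_N-\mathbf{v}_{N-1}\|^2\big]\le2\Lambda_1\epsilon^2=\mathcal{O}(\epsilon^2)$ after at most $N=\big\lceil\frac{\sqrt{\Lambda_0}}{\sqrt{\Lambda_1}\,\epsilon}\big\rceil=\mathcal{O}\big(\frac{L\|\mathbf{u}_0-\mathbf{u}^*\|}{\epsilon}\big)$ iterations. The total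 number of oracle queries to $\widehat F$ is $$\mathcal{O}\Big(\frac{\sigma^2L\|\mathbf{u}_0-\mathbf{u}^*\|+L^3\|\mathbf{u}_0-\mathbf{u}^*\|^3}{\epsilon^3}\Big)$$ in expectation.
   Context: $\|\cdot\|$ is induced by an inner product on $\mathbb{R}^d$. $F$ is monotone if $\langle F(\mathbf{u})-F(\mathbf{v}),\mathbf{u}-\mathbf{v}\rangle\ge0$ for all $\mathbf{u},\mathbf{v}$. A solution $\mathbf{u}^*$ is assumed to exist. Oracle. $P_z$ is a probability distribution; for $z\sim P_z$ and all $\mathbf{x},\mathbf{u},\mathbf{v}\in\mathbb{R}^d$: $\mathbb{E}_z[\widehat F(\mathbf{x},z)]=F(\mathbf{x})$; $\mathbb{E}_z[\|\widehat F(\mathbf{x},z)-F(\mathbf{x})\|^2]\le\sigma^2$; $\mathbb{E}_z[\|\widehat F(\mathbf{u},z)-\widehat F(\mathbf{v},z)\|^2]\le L^2\|\mathbf{u}-\mathbf{v}\|^2$. The oracle can be queried at several points with the same $z$. Each evaluation $\widehat F(\mathbf{x},z)$ counts as one query. Algorithm 2 (Extrapolated Stochastic Halpern-Monotone). Set $\mathbf{v}_{-1}=\mathbf{u}_0$, $S_1^{(-1)}=\lceil8\sigma^2/\epsilon^2\rceil$, $\widetilde F(\mathbf{v}_{-1})=\frac1{S_1^{(-1)}}\sum_{i=1}^{S_1^{(-1)}}\widehat F(\mathbf{v}_{-1},z_i^{(-1)})$. For $k=1,2,\dots$ (up to $k=N$, returning $\mathbf{u}_N$): (1) $\mathbf{v}_{k-1}=\frac1{k+1}\mathbf{u}_0+\frac{k}{k+1}\mathbf{u}_{k-1}-\eta_{k-1}\widetilde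 F(\mathbf{v}_{k-2})$; (2) $p_{k-1}=\min(\frac2k,1)$, $S_1^{(k-1)}=\lceil\frac{8\sigma^2}{p_{k-1}\epsilon^2}\rceil$, $S_2^{(k-1)}=\lceil\frac{8L^2\|\mathbf{v}_{k-1}-\mathbf{v}_{k-2}\|^2}{p_{k-1}^2\epsilon^2}\rceil$; (3) with probability $p_{k-1}$ set $\widetilde F(\mathbf{v}_{k-1})=\frac1{S_1^{(k-1)}}\sum_{i=1}^{S_1^{(k-1)}}\widehat F(\mathbf{v}_{k-1},z_i^{(k-1)})$, and with probability $1-p_{k-1}$ set $\widetilde F(\mathbf{v}_{k-1})=\widetilde F(\mathbf{v}_{k-2})+\frac1{S_2^{(k-1)}}\sum_{i=1}^{S_2^{(k-1)}}\big(\widehat F(\mathbf{v}_{k-1},z_i^{(k-1)})-\widehat F(\mathbf{v}_{k-2},z_i^{(k-1)})\big)$ (the correction term is $\mathbf{0}$ if $\mathbf{v}_{k-1}=\mathbf{v}_{k-2}$); (4) $\mathbf{u}_k=\frac1{k+1}\mathbf{u}_0+\frac{k}{k+1}\mathbf{u}_{k-1}-\eta_{k-1}\widetilde F(\mathbf{v}_{k-1})$; (5) $\eta_k=\frac{\big(1-\frac1{(k+1)^2}-M\eta_{k-1}^2\big)(k+1)^2}{(1-M\eta_{k-1}^2)\,k(k+2)}\,\eta_{k-1}$. All $z_i^{(j)}\sim P_z$ are i.i.d.; the samples and coin flip used at each step are independent of each other and of the past. $\mathcal{O}(\cdot)$ is in the regime of small $\epsilon$ with the other parameters fixed (and $\mathbf{u}_0\neq\mathbf{u}^*$);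 the hidden constants are absolute for $\eta_0$ of order $1/L$, i.e. they may depend on the product $L\eta_0$ only. *)

(* Defs.v *)
From HB Require Import structures.
From mathcomp Require Export all_boot all_order all_algebra finmap.
From mathcomp Require Export all_classical all_reals all_analysis.
From mathcomp Require Export sesquilinear.
Export Order.TTheory GRing.Theory Num.Theory.
Export numFieldNormedType.Exports.

Set Implicit Arguments.
Unset Strict Implicit.
Unset Printing Implicit Defensive.

Local Open Scope classical_set_scope.
Local Open Scope ring_scope.

Definition dot_norm (R : realType) (d : nat) (dot : {dot 'rV[R]_d for idfun})
  (x : 'rV[R]_d) : R := Num.sqrt (dot x x).

Definition monotone_operator (R : realType) (d : nat)
    (dot : {dot 'rV[R]_d for idfun}) (F : 'rV[R]_d -> 'rV[R]_d) : Prop :=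
  forall x y, 0 <= dot (F x - F y) (x - y).

Definition lipschitz_operator (R : realType) (d : nat)
    (dot : {dot 'rV[R]_d for idfun}) (L : R)
    (F : 'rV[R]_d -> 'rV[R]_d) : Prop :=
  forall x y, dot_norm dot (F x - F y) <= L * dot_norm dot (x - y).

(* Joint Borel measurability of (x, z) |-> Fhat x z is what makes the oracle
   usable at the random iterates.  It is stated coordinatewise, with the
   product sigma-algebra on d.-tuple R playing the role of the Borel
   sigma-algebra of R^d. *)
Record stochastic_oracle (R : realType) (d : nat)
    (dot : {dot 'rV[R]_d for idfun}) (F : 'rV[R]_d -> 'rV[R]_d)
    (dZ : measure_display) (Z : measurableType dZ) (Pz : probability Z R)
    (Fhat : 'rV[R]_d -> Z -> 'rV[R]_d) (sigma L : R) : Prop := {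
  oracle_measurable : forall j : 'I_d,
    measurable_fun [set: d.-tuple R * Z]
      (fun p => Fhat (\row_i tnth p.1 i) p.2 0 j);
  oracle_unbiased : forall (x : 'rV[R]_d) (j : 'I_d),
    ('E_Pz[fun z => (Fhat x z 0 j)%R])%E = (F x 0 j)%:E;
  oracle_variance : forall x : 'rV[R]_d,
    ('E_Pz[fun z => (dot_norm dot (Fhat x z - F x) ^+ 2)%R]
       <= (sigma ^+ 2)%:E)%E;
  oracle_lipschitz : forall x y : 'rV[R]_d,
    ('E_Pz[fun z => (dot_norm dot (Fhat x z - Fhat y z) ^+ 2)%R]
       <= (L ^+ 2 * dot_norm dot (x - y) ^+ 2)%:E)%E }.

Definition ceiln (R : realType) (x : R) : nat := `|Num.ceil x|%N.

(* p_j = min(2 / (j + 1), 1) *)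
Definition coin_prob (R : realType) (j : nat) : R :=
  Num.min (2 / j.+1%:R) 1.

(* eta_k, given M and eta_0 *)
Fixpoint step_size (R : realType) (M eta0 : R) (k : nat) : R :=
  if k is k'.+1 then
    let e := step_size M eta0 k' in
    (1 - 1 / (k.+1%:R) ^+ 2 - M * e ^+ 2) * k.+1%:R ^+ 2
      / ((1 - M * e ^+ 2) * k%:R * k.+2%:R) * e
  else eta0.

Definition batch_mean (R : realType) (d n : nat) (f : nat -> 'rV[R]_d) :
  'rV[R]_d := n%:R^-1 *: \sum_(i < n) f i.

(* The maximum only matters when sigma = 0, where the formula gives an empty
   batch, whose average is undefined; one (exact) sample is drawn instead. *)
Definition batch1 (R : realType) (sigma eps p : R) : nat :=
  maxn 1 (ceiln (8 * sigma ^+ 2 / (p * eps ^+ 2))).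

(* This is 0 when v = v', and then batch_mean makes the correction term 0. *)
Definition batch2 (R : realType) (d : nat) (dot : {dot 'rV[R]_d for idfun})
    (L eps p : R) (v v' : 'rV[R]_d) : nat :=
  ceiln (8 * L ^+ 2 * dot_norm dot (v - v') ^+ 2 / (p ^+ 2 * eps ^+ 2)).

(* The state after k iterations: u_k, v_{k-1} and Ftilde(v_{k-1}). *)
Record halpern_state (R : realType) (d : nat) := HalpernState {
  iter_u : 'rV[R]_d;
  iter_v : 'rV[R]_d;
  iter_Ft : 'rV[R]_d }.

Section Algorithm.
Context (R : realType) (d : nat) (dot : {dot 'rV[R]_d for idfun}) (Z : Type)
  (Fhat : 'rV[R]_d -> Z -> 'rV[R]_d) (sigma L eta0 eps : R) (u0 : 'rV[R]_d).

(* One sample path: z b i is the i-th sample (from 0) of superscript (b - 1),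
   so z 0 is the initial batch; coin j = true selects the fresh batch in the
   step with superscript j. *)
Context (z : nat -> nat -> Z) (coin : nat -> bool).

Fixpoint halpern (k : nat) : halpern_state R d :=
  if k is j.+1 then
    let s := halpern j in
    let anchor := (1 / k.+1%:R) *: u0 + (k%:R / k.+1%:R) *: iter_u s in
    let eta := step_size (9 * L ^+ 2) eta0 j in
    let v := anchor - eta *: iter_Ft s in
    let Ft :=
      if coin j then
        batch_mean (batch1 sigma eps (coin_prob R j)) (fun i => Fhat v (z k i))
      else
        iter_Ft s + batch_mean (batch2 dot L eps (coin_prob R j) v (iter_v s))
                      (fun i => Fhat v (z k i) - Fhat (iter_v s) (z k i)) in
    HalpernState (anchor - eta *: Ft) v Ft
  else
    HalpernState u0 u0
      (batch_mean (batch1 sigma eps 1) (fun i => Fhat u0 (z 0%N i))).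

(* Number of evaluations of Fhat made by N iterations. *)
Definition halpern_queries (N : nat) : nat :=
  (batch1 sigma eps 1 +
   \sum_(j < N)
     if coin j then batch1 sigma eps (coin_prob R j)
     else 2 * batch2 dot L eps (coin_prob R j)
                (iter_v (halpern j.+1)) (iter_v (halpern j)))%N.

End Algorithm.

Definition mutually_independent (R : realType) (dO : measure_display)
    (Omega : measurableType dO) (P : probability Omega R) (I : choiceType)
    (G : I -> set (set Omega)) : Prop :=
  forall (J : {fset I}) (A : I -> set Omega), (forall i, i \in J -> G i (A i)) ->
    (P (\bigcap_(i in [set` J]) A i) = \prod_(i <- J) P (A i))%E.

Record algorithm_randomness (R : realType)
    (dZ : measure_display) (Z : measurableType dZ) (Pz : probability Z R)
    (dO : measure_display) (Omega : measurableType dO)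
    (P : probability Omega R)
    (z : nat -> nat -> {RV P >-> Z}) (coin : nat -> {RV P >-> bool}) : Prop := {
  sample_law : forall (b i : nat) (A : set Z), measurable A ->
    distribution P (z b i) A = Pz A;
  coin_law : forall j : nat,
    P [set w | coin j w = true] = (coin_prob R j)%:E;
  sample_coin_independent :
    mutually_independent P (fun x : (nat * nat) + nat =>
      match x with
      | inl bi => preimage_set_system setT (z bi.1 bi.2) measurable
      | inr j => preimage_set_system setT (coin j) measurable
      end) }.

(* Main.v *)
From HB Require Import structures.
Require Import Defs.
From mathcomp Require Import ring lra measurable_realfun.

Set Implicit Arguments.
Unset Strict Implicit.
Unset Printing Implicit Defensive.

Local Open Scope classical_set_scope.
Local Open Scope ring_scope.

(** Why the theorem holds.  The argument has a deterministic half, valid along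
    every sample path, and a probabilistic half; expectations are taken only
    at the very end, on an inequality that is linear in nonnegative terms.

    Deterministic half.  Let err k be the squared distance between the
    estimate used by the algorithm at the point v_{k-1} and F v_{k-1}.  Put
    A_k = eta_k (k+1)(k+2)/2 and
      V_k = A_k (|F u_k|^2 + L^2 |u_k - v_{k-1}|^2) + (k+1) <F u_k, u_k - u_0>.
    Monotonicity of F between consecutive iterates, multiplied by k(k+1),
    telescopes the inner products; the Lipschitz bound compares F u_k with
    F v_{k-1}; and the recursion that defines eta_k is the one for which the
    quadratic form left over is the negative of a square.  Hence V_k increases
    by at most a multiple of the errors ([halpern_potential_step],
    [potentialS]).  The steps decrease to a limit that is at least eta_lim > 0
    ([step_size_bounds]), so A_k grows like k^2, while monotonicity between
    u_k and the solution bounds <F u_k, u_k - u_0> from below.  Dividing by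
    A_k bounds the residual by Lambda_0 / ((k+1)(k+2)) plus a weighted sum of
    past errors ([sqr_residual_le]).

    Probabilistic half.  The error e_k of the estimator in mean square obeys
      e_{k+1} <= p^2 eps^2/8 + (1 - p) (e_k + p^2 eps^2/8),  p = min(2/(k+1), 1),
    whence e_k <= eps^2/k for k >= 1 ([oracle_error_recursion], [oracle_errorS_le]).
    Conditional expectations are replaced by Tonelli's theorem: the pair made
    of the history and of one fresh sample has a product law, so the sample is
    integrated out with the history frozen ([history_tonelli]).  A batch is
    consumed one sample at a time, each centred sample adding only its second
    moment ([one_sample_sqr]); as the size of a correction batch is random,
    partial sums are truncated at m samples and Fatou's lemma is used as m
    tends to infinity ([batch_mean_sqr]).

    Combination.  The weights of the sum of errors, of order k^2, meet errors
    of order eps^2/k; the sum is of order k^2 eps^2 and leaves Lambda_1 eps^2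
    after the division by A_k.  This works for every k >= 0, hence also when N
    is 0 or 1 ([mean_residual]).  For k <= N the same bounds make the estimate
    at v_{k-1} of mean square O(L^2 dist^2/(k+1)^2), so u_k stays within O(dist)
    of u_0 by convexity and consecutive query points are O(dist/(k+1)) apart
    ([mean_away], [mean_extrapolation]).  A correction batch thus costs
    O(L^2 dist^2/eps^2) evaluations on average and a fresh
    batch, drawn with probability p, O(sigma^2/eps^2); there are
    N = O(L dist/eps) iterations ([mean_queries]). *)

(** * Inner products and the one-step potential inequality *)

Section DotProduct.
Context (R : realType) (d : nat) (dot : {dot 'rV[R]_d for idfun}).
Implicit Types (x y z : 'rV[R]_d) (c s : R).

Lemma dotC x y : dot x y = dot y x.
Proof. by rewrite hermC expr0 mul1r. Qed.

Lemma dotDl x y z : dot (x + y) z = dot x z + dot y z.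
Proof. by rewrite linearDl. Qed.

Lemma dotDr x y z : dot z (x + y) = dot z x + dot z y.
Proof. by rewrite dotC dotDl !(dotC z). Qed.

Lemma dotZl c x y : dot (c *: x) y = c * dot x y.
Proof. by rewrite linearZl_LR. Qed.

Lemma dotZr c x y : dot x (c *: y) = c * dot x y.
Proof. by rewrite dotC dotZl dotC. Qed.

Lemma dotNl x y : dot (- x) y = - dot x y.
Proof. by rewrite -scaleN1r dotZl mulN1r. Qed.

Lemma dotNr x y : dot x (- y) = - dot x y.
Proof. by rewrite dotC dotNl dotC. Qed.

Lemma dot0l y : dot 0 y = 0.
Proof. by rewrite -(scale0r 0) dotZl mul0r. Qed.

Lemma dot0r x : dot x 0 = 0.
Proof. by rewrite dotC dot0l. Qed.

Lemma dot_ge0 x : 0 <= dot x x.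
Proof.
have [->|x0] := eqVneq x 0; first by rewrite dot0l.
exact/ltW/neq0_dnorm_gt0.
Qed.

Lemma dot_eq0 x : dot x x = 0 -> x = 0.
Proof.
move=> xx0; apply/eqP/negPn/negP => x0.
suff : 0 < dot x x by rewrite xx0 ltxx.
exact: neq0_dnorm_gt0.
Qed.

Lemma sqr_dot_norm x : dot_norm dot x ^+ 2 = dot x x.
Proof. by rewrite sqr_sqrtr// dot_ge0. Qed.

Definition dotE := (dotDl, dotDr, dotNl, dotNr, dotZl, dotZr).

Lemma dot_young s x y : 0 < s ->
  2 * dot x y <= s * dot x x + s^-1 * dot y y.
Proof.
move=> s0; have := dot_ge0 (s *: x - y); rewrite !dotE (dotC y x) => H.
rewrite -(ler_pM2l s0) mulrDr mulrA (mulrA s s^-1) divff ?gt_eqF// mul1r; lra.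
Qed.

Lemma dot_sqrD_le2 x y : dot (x + y) (x + y) <= 2 * dot x x + 2 * dot y y.
Proof. have := dot_ge0 (x - y); rewrite !dotE; lra. Qed.

Lemma dot_sqrD_le3 x y z :
  dot (x + y + z) (x + y + z) <= 3 * dot x x + 3 * dot y y + 3 * dot z z.
Proof.
have := dot_ge0 (x - y); have := dot_ge0 (x - z); have := dot_ge0 (y - z).
rewrite !dotE; lra.
Qed.

End DotProduct.

Section PotentialStep.
Context (R : realType) (d : nat) (dot : {dot 'rV[R]_d for idfun})
  (F : 'rV[R]_d -> 'rV[R]_d) (L : R).
Hypotheses (L0 : 0 < L) (Fmono : monotone_operator dot F)
  (Flip : lipschitz_operator dot L F).

Lemma lipschitz_sqr x y :
  dot (F x - F y) (F x - F y) <= L ^+ 2 * dot (x - y) (x - y).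
Proof.
rewrite -!sqr_dot_norm -exprMn lerXn2r ?nnegrE ?mulr_ge0 ?sqrtr_ge0 ?(ltW L0)//.
Qed.

(** One step of the algorithm, with n = k, h = eta_{k-1}, p = u_{k-1} and
    r = v_{k-2}; G and H are the estimates at v = v_{k-1} and at r.  Here
    x = M h^2, and B and A are A_{k-1} and A_k once the recursion for the step
    size is unfolded.  The only sources of loss are the two errors: every
    other term is absorbed because x <= 1/3. *)
Lemma halpern_potential_step (n h x B A : R) (u0 u v p r G H : 'rV[R]_d) :
  1 <= n -> 0 < h -> x = 9 * L ^+ 2 * h ^+ 2 -> x <= 1 / 3 ->
  B = h * n * (n + 1) / 2 ->
  A = B * (((n + 1) ^+ 2 * (1 - x) - 1) / ((1 - x) * n ^+ 2)) ->
  u = 1 / (n + 1) *: u0 + n / (n + 1) *: p - h *: G ->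
  v = 1 / (n + 1) *: u0 + n / (n + 1) *: p - h *: H ->
  A * (dot (F u) (F u) + L ^+ 2 * dot (u - v) (u - v))
    + (n + 1) * dot (F u) (u - u0) <=
  B * (dot (F p) (F p) + L ^+ 2 * dot (p - r) (p - r))
    + n * dot (F p) (p - u0)
  + 2 * (B / x) * dot (G - F v) (G - F v) + 2 * B * dot (H - F r) (H - F r).
Proof.
move=> n1 h0 xE xle BE AE uE vE.
have n0 : 0 < n by lra.
have x0 : 0 < x by rewrite xE !mulr_gt0 ?exprn_gt0.
have B0 : 0 < B by rewrite BE !mulr_gt0//; lra.
have lw := lipschitz_sqr u v; have lr := lipschitz_sqr p r.
have wE : dot (u - v) (u - v) = h ^+ 2 * dot (G - H) (G - H).
  have -> : u - v = h *: (H - G).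
    by rewrite uE vE; apply/rowP => j; rewrite !mxE; ring.
  by rewrite !dotE (dotC dot H G); ring.
set w2 := dot (u - v) (u - v) in wE lw *.
set r2 := dot (p - r) (p - r) in lr *.
move eqs : (u - u0) => s; move eqt : (p - u0) => t.
have sE : s = n / (n + 1) *: t - h *: G.
  rewrite -eqs -eqt uE scalerBr (_ : n / (n + 1) = 1 - 1 / (n + 1)); last first.
    by field; lra.
  by rewrite !scalerBl !scale1r; apply/rowP => j; rewrite !mxE; ring.
have mono : (n + 1) * dot (F u) s <=
    n * dot (F p) t + 2 * B * dot (F p) G - (n + 1) ^+ 2 * h * dot (F u) G.
  have := Fmono u p; have -> : u - p = s - t by rewrite -eqs -eqt opprB addrA subrK.
  rewrite !dotE => m.
  have e1 : dot (F p) s = n / (n + 1) * dot (F p) t - h * dot (F p) G.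
    by rewrite sE !dotE.
  have e2 : dot (F u) t = (n + 1) / n * (dot (F u) s + h * dot (F u) G).
    by rewrite sE !dotE; field; apply/andP; split; lra.
  have nn : 0 <= n * (n + 1) by nra.
  have := mulr_ge0 nn m; rewrite e1 e2 => {}m; rewrite -subr_ge0.
  apply: le_trans m _.
  by rewrite BE le_eqVlt; apply/orP; left; apply/eqP; field; lra.
set b := F u in lw mono *; set a := F p in lr mono *.
pose tau := B / x; rewrite -/tau.
have t0 : 0 < tau by rewrite divr_gt0.
have tx : tau * x = B by rewrite /tau divfK// gt_eqF.
(* What remains of the terms in b and G once tau |b - G|^2 is split off.  With
   tau = B / x the discriminant of this form vanishes exactly for the given A,
   and the form is - (tau - B) |G - c b|^2. *)
have quad : (A - tau) * dot b b + (2 * tau - (n + 1) ^+ 2 * h) * dot b G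
    + (B - tau) * dot G G <= 0.
  pose c := (n - (n + 1) * x) / (n * (1 - x)).
  have := dot_ge0 dot (G - c *: b); rewrite !dotE (dotC dot b G) => sq.
  have tB : 0 <= tau - B.
    by rewrite subr_ge0 -tx ler_piMr; lra.
  have := mulr_ge0 tB sq; rewrite -oppr_le0; apply: le_trans.
  rewrite le_eqVlt; apply/orP; left; apply/eqP.
  rewrite AE /c /tau BE; field; rewrite !gt_eqF//; lra.
have bG : dot (b - G) (b - G) <= 2 * L ^+ 2 * w2
    + 2 * dot (G - F v) (G - F v).
  have := dot_sqrD_le2 dot (b - F v) (F v - G).
  rewrite addrA subrK -(opprB G (F v)) !dotNl !dotNr opprK; lra.
(* G and H are compared through a = F p, which is close to H. *)
have GH : dot (G - H) (G - H) <= 2 * dot (a - G) (a - G)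
    + 2 * dot (a - H) (a - H).
  have := dot_sqrD_le2 dot (G - a) (a - H).
  by rewrite addrA subrK -(opprB a G) !dotNl !dotNr opprK; lra.
have aH : dot (a - H) (a - H) <= 3 / 2 * (L ^+ 2 * r2)
    + 3 * dot (H - F r) (H - F r).
  have := dot_ge0 dot ((a - F r) - 2 *: (F r - H)).
  have -> : dot (a - H) (a - H)
      = dot ((a - F r) + (F r - H)) ((a - F r) + (F r - H)).
    by rewrite addrA subrK.
  rewrite -(opprB (F r) H) !dotNl !dotNr opprK.
  move: lr; move: (a - F r) (F r - H) => X Y lr.
  by rewrite !(dotDl, dotDr, dotNl, dotNr, dotZl, dotZr) (dotC dot Y X); lra.
have AB : A <= 3 * B.
  rewrite AE (mulrC 3) ler_pM2l// ler_pdivrMr; last first.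
    by rewrite mulr_gt0 ?exprn_gt0//; lra.
  have nn : 0 <= n * (n - 1) by rewrite mulr_ge0; lra.
  have x1 : 0 <= 1 - x by lra.
  have := mulr_ge0 x1 nn; lra.
have wle : (2 * tau + A) * (L ^+ 2 * w2) <= B / 3 * dot (G - H) (G - H).
  have -> : (2 * tau + A) * (L ^+ 2 * w2)
      = (2 * (tau * x) + A * x) / 9 * dot (G - H) (G - H).
    by rewrite wE xE; field.
  rewrite tx ler_wpM2r ?dot_ge0//.
  have := ler_wpM2r (ltW x0) AB; nra.
have := ler_wpM2l (ltW t0) bG.
have := ler_wpM2l (ltW B0) GH; have := ler_wpM2l (ltW B0) aH.
move: mono quad wle.
rewrite !(dotDl _ b) !(dotDr _ b) !(dotDl _ a) !(dotDr _ a) !dotNl !dotNr.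
rewrite (dotC dot G b) (dotC dot G a).
have := mulr_ge0 (ltW B0) (dot_ge0 dot (a - G)).
rewrite !(dotDl _ a) !(dotDr _ a) !dotNl !dotNr (dotC dot G a).
lra.
Qed.

End PotentialStep.

(** * Step sizes *)

Section StepSize.
Context (R : realType) (M e0 : R).
Hypotheses (M0 : 0 < M) (e00 : 0 < e0) (Me : M * e0 ^+ 2 <= 1 / 3).
Local Notation eta := (step_size M e0).

(** (n+1)^2 / (n (n+2)) = 1 + 1/(n (n+2)), so the ratio of consecutive steps is
    1 minus a summable quantity. *)
Lemma step_sizeS k : 1 - M * eta k ^+ 2 != 0 ->
  eta k.+1 = eta k * (1 - M * eta k ^+ 2 / (1 - M * eta k ^+ 2)
                          / (k.+1%:R * k.+3%:R)).
Proof.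
move=> nz /=.
have k0 : 0 <= k%:R :> R by [].
have -> : k.+3%:R = k%:R + 3 :> R by rewrite -addn3 natrD.
have -> : k.+2%:R = k%:R + 2 :> R by rewrite -addn2 natrD.
have -> : k.+1%:R = k%:R + 1 :> R by rewrite -addn1 natrD.
by field; rewrite nz !gt_eqF//; lra.
Qed.

(** The total relative decrease is at most y times the sum of 1/(n (n+2)), which
    is compared with the telescoping sum of 1/n - 1/(n+1). *)
Lemma step_size_bounds k :
  0 < eta k /\
  e0 * (1 - M * e0 ^+ 2 / (1 - M * e0 ^+ 2) * (1 - k.+1%:R^-1)) <= eta k <= e0.
Proof.
have Me' := Me; pose y := M * e0 ^+ 2 / (1 - M * e0 ^+ 2); rewrite -/y.
have x0 : 0 <= M * e0 ^+ 2 by rewrite mulr_ge0 ?sqr_ge0// ltW.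
have y0 : 0 <= y by rewrite /y divr_ge0//; lra.
have y1 : y <= 1 / 2 by rewrite /y ler_pdivrMr; lra.
elim: k => [|k [IH0 /andP[IHl IHu]]].
  by split=> //; rewrite invr1 subrr mulr0 subr0 mulr1 lexx.
have k1 : 1 <= k.+1%:R :> R by rewrite ler1n.
have k0 : 0 < k.+1%:R :> R by [].
have xk : M * eta k ^+ 2 <= M * e0 ^+ 2.
  by rewrite ler_pM2l// lerXn2r ?nnegrE// ltW.
have xk0 : 0 <= M * eta k ^+ 2 by rewrite mulr_ge0 ?sqr_ge0// ltW.
have nz : 1 - M * eta k ^+ 2 != 0 by rewrite gt_eqF//; lra.
rewrite step_sizeS//; set yk := _ / (1 - M * eta k ^+ 2).
have yk0 : 0 <= yk by rewrite /yk divr_ge0//; lra.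
have yky : yk <= y.
  rewrite /yk /y ler_pdivrMr; last by lra.
  rewrite mulrAC ler_pdivlMr; last by lra.
  nra.
have -> : k.+3%:R = k.+1%:R + 2 :> R by rewrite -addn2 natrD.
have -> : k.+2%:R = k.+1%:R + 1 :> R by rewrite -addn1 natrD.
move: (k.+1%:R) k0 k1 IHl => n n0 n1 IHl.
have n2 : 0 < n * (n + 2) by nra.
set c := yk / _.
have c0 : 0 <= c by rewrite divr_ge0// ltW.
have cy : c <= y / (n * (n + 2)) by rewrite ler_pM2r ?invr_gt0.
have cn : y / (n * (n + 2)) <= y * (n^-1 - (n + 1)^-1).
  rewrite ler_wpM2l// (_ : n^-1 - (n + 1)^-1 = (n * (n + 1))^-1); last first.
    by field; rewrite !gt_eqF//; lra.
  by rewrite lef_pV2 ?posrE ?ler_pM2l//; nra.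
have c1 : c < 1.
  rewrite /c ltr_pdivrMr ?mul1r//.
  by apply: le_lt_trans (le_trans yky y1) _; nra.
split; first by rewrite mulr_gt0// subr_gt0.
apply/andP; split; last by apply: le_trans IHu; rewrite ler_piMr ?(ltW IH0)// lerBlDr lerDl.
have : eta k * c <= e0 * (y * (n^-1 - (n + 1)^-1)).
  apply: ler_pM => //; [exact: ltW|exact: le_trans cn].
lra.
Qed.

End StepSize.

(** * Pathwise analysis of a run *)

Section Path.
Context (R : realType) (d : nat) (dot : {dot 'rV[R]_d for idfun})
  (F : 'rV[R]_d -> 'rV[R]_d) (L e0 : R) (u0 us : 'rV[R]_d)
  (Z : Type) (Fhat : 'rV[R]_d -> Z -> 'rV[R]_d) (sigma eps : R)
  (z : nat -> nat -> Z) (coin : nat -> bool).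
Hypotheses (L0 : 0 < L) (Fmono : monotone_operator dot F)
  (Flip : lipschitz_operator dot L F) (Fus : F us = 0)
  (e00 : 0 < e0) (Me : 9 * L ^+ 2 * e0 ^+ 2 <= 1 / 3).

Local Notation M := (9 * L ^+ 2).
Local Notation eta := (step_size M e0).
Local Notation state := (halpern dot Fhat sigma L e0 eps u0 z coin).

Definition oracle_error k :=
  dot (iter_Ft (state k) - F (iter_v (state k)))
      (iter_Ft (state k) - F (iter_v (state k))).
Local Notation err := oracle_error.

(** The quantity whose mean the theorem bounds. *)
Definition sqr_residual k :=
  dot (F (iter_u (state k))) (F (iter_u (state k)))
  + 2 * L ^+ 2 * dot (iter_u (state k) - iter_v (state k))
                     (iter_u (state k) - iter_v (state k)).
Local Notation res := sqr_residual.

Definition eta_lim := e0 * (1 - 2 * M * e0 ^+ 2) / (1 - M * e0 ^+ 2).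
Local Notation eta_ := eta_lim.
Local Notation dist2 := (dot (u0 - us) (u0 - us)).

Let M0 : 0 < M. Proof. by rewrite mulr_gt0 ?exprn_gt0. Qed.

Lemma eta_lim_gt0 : 0 < eta_.
Proof.
have Me' := Me; have M0' := M0.
by rewrite /eta_lim divr_gt0 ?mulr_gt0//; lra.
Qed.

Lemma eta_limE : eta_ = e0 * (1 - M * e0 ^+ 2 / (1 - M * e0 ^+ 2)).
Proof. by have Me' := Me; rewrite /eta_lim; field; rewrite gt_eqF//; lra. Qed.

Lemma step_size_gt0 k : 0 < eta k.
Proof. by have [] := step_size_bounds M0 e00 Me k. Qed.

Lemma step_size_le k : eta k <= e0.
Proof. by have [_ /andP[]] := step_size_bounds M0 e00 Me k. Qed.

Lemma eta_lim_le_step_size k : eta_ <= eta k.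
Proof.
have [_ /andP[+ _]] := step_size_bounds M0 e00 Me k; apply: le_trans.
have Me' := Me; have x0 : 0 <= M * e0 ^+ 2 by rewrite mulr_ge0 ?sqr_ge0// ltW.
rewrite eta_limE ler_pM2l// lerB// ler_piMr ?lerBlDr ?lerDl ?invr_ge0// divr_ge0//; lra.
Qed.

(** The coefficient A_k of the potential V_k. *)
Definition weight k : R := eta k * k.+1%:R * k.+2%:R / 2.

Lemma weight_gt0 k : 0 < weight k.
Proof. by rewrite /weight !mulr_gt0// step_size_gt0. Qed.

Definition potential k :=
  weight k * (dot (F (iter_u (state k))) (F (iter_u (state k)))
     + L ^+ 2 * dot (iter_u (state k) - iter_v (state k))
                    (iter_u (state k) - iter_v (state k)))
  + k.+1%:R * dot (F (iter_u (state k))) (iter_u (state k) - u0).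

(** What the errors add to the potential in one step, once the current step size
    is replaced by its bounds eta_lim and e0. *)
Definition step_noise k : R := k.+1%:R * k.+2%:R * (err k.+1 / (M * eta_) + e0 * err k).

Lemma oracle_error_ge0 k : 0 <= err k. Proof. exact: dot_ge0. Qed.

Lemma potentialS k : potential k.+1 <= potential k + step_noise k.
Proof.
pose x := M * eta k ^+ 2; pose n : R := k.+1%:R.
have e0k := step_size_gt0 k.
have n1 : 1 <= n by rewrite ler1n.
have nE : k.+2%:R = n + 1 by rewrite /n -addn1 natrD.
have nE2 : k.+3%:R = n + 2 by rewrite /n -addn2 natrD.
have xle : x <= 1 / 3.
  apply: le_trans Me; rewrite ler_pM2l// lerXn2r ?nnegrE ?step_size_le//;
  exact: ltW.
have x0 : 0 < x by rewrite /x mulr_gt0 ?exprn_gt0.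
have BE : weight k = eta k * n * (n + 1) / 2 by rewrite /weight nE.
have AE : weight k.+1
    = weight k * (((n + 1) ^+ 2 * (1 - x) - 1) / ((1 - x) * n ^+ 2)).
  rewrite BE /weight step_sizeS; last by rewrite -/x gt_eqF//; lra.
  rewrite -/x nE nE2 -/n; field; rewrite !gt_eqF//; lra.
have uE : iter_u (state k.+1) = 1 / (n + 1) *: u0
    + n / (n + 1) *: iter_u (state k) - eta k *: iter_Ft (state k.+1).
  by rewrite -nE.
have vE : iter_v (state k.+1) = 1 / (n + 1) *: u0
    + n / (n + 1) *: iter_u (state k) - eta k *: iter_Ft (state k).
  by rewrite -nE.
have := halpern_potential_step L0 Fmono Flip (iter_v (state k)) n1 e0k
  (erefl : x = M * eta k ^+ 2) xle BE AE uE vE.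
rewrite /potential nE -/n => /le_trans; apply.
rewrite -[leLHS]addrA lerD2l.
rewrite /step_noise -/(err k.+1) -/(err k) nE -/n mulrDr; apply: lerD.
- have -> : 2 * (weight k / x) = n * (n + 1) / (M * eta k).
    by rewrite BE /x; field; rewrite !gt_eqF//.
  rewrite [_ / (M * eta_)]mulrC [leRHS]mulrA.
  apply: ler_wpM2r; first exact: oracle_error_ge0.
  apply: ler_wpM2l; first by rewrite mulr_ge0; lra.
  rewrite lef_pV2 ?posrE ?(mulr_gt0 M0 eta_lim_gt0) ?(mulr_gt0 M0 e0k)//.
  by rewrite ler_pM2l// eta_lim_le_step_size.
- rewrite [leRHS]mulrA; apply: ler_wpM2r; first exact: oracle_error_ge0.
  rewrite BE (_ : 2 * _ = n * (n + 1) * eta k); last by field.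
  by apply: ler_wpM2l; [rewrite mulr_ge0; lra|exact: step_size_le].
Qed.

Lemma potential_le k :
  potential k <= e0 * L ^+ 2 * dist2 + \sum_(i < k) step_noise i.
Proof.
elim: k => [|k IH]; last first.
  by rewrite big_ord_recr /= addrA; apply: le_trans (potentialS k) _; rewrite lerD2r.
rewrite big_ord0 addr0 /potential /weight /= !subrr.
rewrite dot0l dot0r !mulr0 !addr0 mulr1 mulfK// -mulrA ler_pM2l//.
have := lipschitz_sqr L0 Flip u0 us.
by rewrite Fus subr0.
Qed.

(** Splitting u_k - u_0 at the solution us, monotonicity discards the part
    u_k - us, and Young's inequality with the ratio A_k / (k+1) pays for
    <F u_k, us - u_0> with half of A_k |F u_k|^2.  This half is why the
    residual carries the factor 2 in front of L^2. *)
Lemma sqr_residual_le k :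
  res k <= 4 * (L ^+ 2 * e0 * eta_ + 1) * dist2 / eta_ ^+ 2
             / (k.+1%:R * k.+2%:R)
           + 4 / (eta_ * (k.+1%:R * k.+2%:R)) * \sum_(i < k) step_noise i.
Proof.
have := potential_le k; set S := \sum_(i < k) _ => Vle.
have A0 := weight_gt0 k; have el0 := eta_lim_gt0.
have := Fmono (iter_u (state k)) us; rewrite Fus subr0.
set b := F (iter_u (state k)) => mono.
have low : - dot b b * (weight k / k.+1%:R) / 2 - dist2 * (k.+1%:R / weight k) / 2
   <= dot b (iter_u (state k) - u0).
  have -> : iter_u (state k) - u0 = (iter_u (state k) - us) - (u0 - us).
    by apply/rowP => j; rewrite !mxE; ring.
  rewrite dotDr dotNr.
  have := @dot_young _ _ dot (weight k / k.+1%:R) b (u0 - us).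
  rewrite invf_div => /(_ (divr_gt0 A0 (ltr0Sn _ _))).
  move: (weight k / _) (_ / weight k) mono => c c'; lra.
have {}Vle : weight k / 2 * res k <= dist2 / eta_ + e0 * L ^+ 2 * dist2 + S.
  have k0 : 0 < k.+1%:R :> R by [].
  have := ler_wpM2l (ltW k0) low.
  have -> : k.+1%:R * (- dot b b * (weight k / k.+1%:R) / 2 -
      dist2 * (k.+1%:R / weight k) / 2) = - weight k / 2 * dot b b
      - dist2 * (k.+1%:R ^+ 2 / (2 * weight k)).
    by move: (weight k) A0 => w A0; field; rewrite !gt_eqF.
  have : dist2 * (k.+1%:R ^+ 2 / (2 * weight k)) <= dist2 / eta_.
    have w2 : 0 < 2 * weight k by apply: mulr_gt0.
    rewrite ler_wpM2l ?dot_ge0// ler_pdivrMr// mulrC.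
    rewrite ler_pdivlMr// /weight.
    have := eta_lim_le_step_size k; have : k.+1%:R <= k.+2%:R :> R by rewrite ler_nat.
    move: (k.+1%:R) (k.+2%:R) (eta k) k0 => n m h n0 nm hl.
    rewrite (_ : 2 * _ = n * (m * h)); last by field.
    rewrite expr2 -mulrA ler_pM2l// ler_pM//; exact: ltW.
  move: Vle; rewrite /potential /sqr_residual -/b.
  move: (dist2 * (k.+1%:R ^+ 2 / _)) (dist2 / eta_) (k.+1%:R * dot b _) => q q' q''.
  lra.
have Alow : eta_ * (k.+1%:R * k.+2%:R) / 4 <= weight k / 2.
  rewrite /weight; have := eta_lim_le_step_size k => /(ler_wpM2r _) => /(_ (k.+1%:R * k.+2%:R)).
  rewrite mulr_ge0// => /(_ isT); lra.
set K : R := k.+1%:R * k.+2%:R in Alow *.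
have K0 : 0 < K by rewrite mulr_gt0.
have -> : 4 * (L ^+ 2 * e0 * eta_ + 1) * dist2 / eta_ ^+ 2 / K + 4 / (eta_ * K) * S
   = (dist2 / eta_ + e0 * L ^+ 2 * dist2 + S) / (eta_ * K / 4).
  by field; rewrite !gt_eqF.
have c0 : 0 < eta_ * K / 4 by apply: divr_gt0 => //; apply: mulr_gt0.
rewrite ler_pdivlMr//; apply: le_trans Vle.
rewrite mulrC; apply: ler_wpM2r => //.
by rewrite addr_ge0 ?dot_ge0// mulr_ge0 ?dot_ge0// mulr_ge0 ?sqr_ge0.
Qed.

(** The estimate is F u_k up to the Lipschitz gap between u_k and v_{k-1} and the
    oracle error, so it inherits the smallness of the residual. *)
Lemma sqr_Ft_le k :
  dot (iter_Ft (state k)) (iter_Ft (state k)) <= 3 * res k + 3 * err k.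
Proof.
set s := state k.
have -> : iter_Ft s = F (iter_u s) + (F (iter_v s) - F (iter_u s))
     + (iter_Ft s - F (iter_v s)) by apply/rowP => j; rewrite !mxE; ring.
have := dot_sqrD_le3 dot (F (iter_u s)) (F (iter_v s) - F (iter_u s))
  (iter_Ft s - F (iter_v s)).
have := lipschitz_sqr L0 Flip (iter_v s) (iter_u s).
rewrite /oracle_error /sqr_residual -/s -(opprB (iter_u s)) dotNl dotNr opprK.
have := mulr_ge0 (sqr_ge0 L) (dot_ge0 dot (iter_u s - iter_v s)); lra.
Qed.

Local Notation away k := (dot (iter_u (state k) - u0) (iter_u (state k) - u0)).

Lemma away_anchorS k :
  away k.+1 <= k.+1%:R / k.+2%:R * away k
    + k.+2%:R * e0 ^+ 2 * (3 * res k.+1 + 3 * err k.+1).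
Proof.
pose n : R := k.+1%:R.
have n1 : 1 <= n by rewrite ler1n.
have nE : k.+2%:R = n + 1 by rewrite /n -addn1 natrD.
set G := iter_Ft (state k.+1).
have -> : iter_u (state k.+1) - u0
   = n / (n + 1) *: (iter_u (state k) - u0) - eta k *: G.
  rewrite [iter_u (state k.+1)](_ : _ = 1 / (n + 1) *: u0
     + n / (n + 1) *: iter_u (state k) - eta k *: G); last by rewrite -nE.
  by apply/rowP => j; rewrite !mxE; field; lra.
have GG : (n + 1) * eta k ^+ 2 * dot G G <=
     (n + 1) * e0 ^+ 2 * (3 * res k.+1 + 3 * err k.+1).
  apply: ler_pM; rewrite ?dot_ge0 ?sqr_Ft_le//.
    by rewrite mulr_ge0 ?sqr_ge0//; lra.
  rewrite ler_wpM2l//; first lra.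
  rewrite lerXn2r ?nnegrE ?step_size_le// ltW// ?step_size_gt0//.
rewrite nE -/n; apply: le_trans (_ : _ <= n / (n + 1) * away k + _) _; last first.
  by rewrite lerD2l; exact: GG.
move: (iter_u (state k) - u0) (eta k) => X h.
(* Convexity of the squared norm: u_{k+1} - u_0 is the mean, with weights
   n/(n+1) and 1/(n+1), of u_k - u_0 and - (n+1) h G. *)
have := dot_ge0 dot (X + ((n + 1) * h) *: G).
rewrite !dotE (dotC dot G X) => H.
have p0 : 0 <= n / (n + 1) ^+ 2 by rewrite divr_ge0 ?sqr_ge0//; lra.
rewrite -subr_ge0; apply: le_trans (mulr_ge0 p0 H) _.
by rewrite le_eqVlt; apply/orP; left; apply/eqP; field; lra.
Qed.

Lemma sqr_extrapolation_le k :
  dot (iter_v (state k.+1) - iter_v (state k))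
      (iter_v (state k.+1) - iter_v (state k)) <=
  3 * (away k / k.+2%:R ^+ 2 + e0 ^+ 2 * (3 * res k + 3 * err k)
        + res k / (2 * L ^+ 2)).
Proof.
pose n : R := k.+1%:R.
have n1 : 1 <= n by rewrite ler1n.
have nE : k.+2%:R = n + 1 by rewrite /n -addn1 natrD.
have -> : iter_v (state k.+1) - iter_v (state k) =
    - (1 / (n + 1)) *: (iter_u (state k) - u0)
    + (- eta k) *: iter_Ft (state k) + (iter_u (state k) - iter_v (state k)).
  rewrite [iter_v (state k.+1)](_ : _ = 1 / (n + 1) *: u0
     + n / (n + 1) *: iter_u (state k) - eta k *: iter_Ft (state k)); last by rewrite -nE.
  by apply/rowP => j; rewrite !mxE; field; lra.
apply: le_trans (dot_sqrD_le3 _ _ _ _) _; rewrite nE !(mulrDr 3 (_ + _)) !(mulrDr 3 (_ / _)).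
apply: lerD; first apply: lerD; rewrite ler_pM2l//.
- rewrite dotZl dotZr le_eqVlt; apply/orP; left; apply/eqP; field; lra.
- rewrite dotZl dotZr mulrA mulrNN -expr2; apply: ler_pM; rewrite ?sqr_ge0 ?dot_ge0 ?sqr_Ft_le//.
  by rewrite lerXn2r ?nnegrE ?step_size_le// ltW// ?step_size_gt0.
- rewrite ler_pdivlMr; last by rewrite mulr_gt0 ?exprn_gt0.
  by rewrite /sqr_residual mulrC lerDr dot_ge0.
Qed.

End Path.

(** * Independence and Tonelli *)

(** The integral of a nonnegative function is the supremum of the integrals of the
    simple functions below it, and enlarging the function enlarges that family. *)
Lemma ge0_le_integral_dominated d (T : measurableType d) (R : realType)
    (mu : {measure set T -> \bar R}) (f g : T -> \bar R) :
  (forall x, 0 <= f x)%E -> (forall x, f x <= g x)%E ->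
  (\int[mu]_x f x <= \int[mu]_x g x)%E.
Proof.
move=> f0 fg; have g0 x : (0 <= g x)%E by exact: le_trans (f0 x) (fg x).
rewrite !ge0_integralTE//; apply: ge_ereal_sup => _ [h hf <-].
by apply: ereal_sup_ubound; exists h => // x; exact: le_trans (hf x) (fg x).
Qed.

Section IndependentPair.
Context (R : realType) (dO d1 d2 : measure_display) (Omega : measurableType dO)
  (T1 : measurableType d1) (T2 : measurableType d2) (P : probability Omega R).
Variables (X : {mfun Omega >-> T1}) (Y : {mfun Omega >-> T2}).
Hypothesis indep : forall A B, measurable A -> measurable B ->
  P (X @^-1` A `&` Y @^-1` B) = (P (X @^-1` A) * P (Y @^-1` B))%E.

(** Independence says that the joint law is the product of the marginals; this is
    the form in which conditioning on X is used throughout. *)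
Lemma independent_tonelli (f : T1 * T2 -> \bar R) :
  measurable_fun [set: T1 * T2] f -> (forall p, 0 <= f p)%E ->
  (\int[P]_w f (X w, Y w) =
   \int[P]_w \int[distribution P Y]_y f (X w, y))%E.
Proof.
move=> mf f0.
have mXY : measurable_fun setT (fun w => (X w, Y w)) by exact: measurable_fun_pair.
pose XY : {mfun Omega >-> (T1 * T2)%type} :=
  HB.pack (fun w => (X w, Y w)) (isMeasurableFun.Build _ _ _ _ _ mXY).
rewrite -[LHS](@ge0_integral_distribution _ _ _ _ _ _ XY)//.
rewrite (eq_measure_integral (distribution P X \x distribution P Y)%E); last first.
  by move=> A mA _; apply/esym/product_measure_unique => // B C; exact: indep.
rewrite fubini_tonelli1//.
rewrite ge0_integral_distribution//.
- exact: measurable_fun_fubini_tonelli_F.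
- by move=> x; apply: integral_ge0.
Qed.

End IndependentPair.

Section FiniteIntersections.
Context (R : realType) (dO : measure_display) (Omega : measurableType dO)
  (P : probability Omega R) (I : choiceType) (G : I -> set (set Omega)).
Hypotheses (Gm : forall i, G i `<=` measurable) (GI : forall i, setI_closed (G i))
  (GT : forall i, G i setT) (ind : mutually_independent P G).

(** A pi-system generating the sigma-algebra of the sources of randomness indexed
    by J; mutual independence speaks of exactly these sets. *)
Definition finite_intersections (J : set I) : set (set Omega) :=
  [set B | exists (K : {fset I}) (A : I -> set Omega),
     (forall i, i \in K -> J i /\ G i (A i)) /\ B = \bigcap_(i in [set` K]) A i].

Lemma finite_intersectionsI J : setI_closed (finite_intersections J).
Proof.
move=> _ _ [K [A [KA ->]]] [K' [A' [KA' ->]]].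
exists (K `|` K')%fset, (fun i => (if i \in K then A i else setT)
   `&` (if i \in K' then A' i else setT)); split.
  move=> i; rewrite in_fsetU => /orP iKK'; split.
    by case: iKK' => [/KA[]|/KA'[]].
  by apply: GI; [case: ifPn => // /KA[]|case: ifPn => // /KA'[]].
apply/seteqP; split => w.
- move=> [wA wA'] i /= _; split; case: ifPn => // iK; [exact: wA|exact: wA'].
- move=> wA; split => i /= iK.
    by have [] := wA i; rewrite /= ?in_fsetU ?iK.
  by have [] := wA i; rewrite /= ?in_fsetU ?iK ?orbT.
Qed.

Lemma finite_intersections_setT J : finite_intersections J setT.
Proof.
exists fset0, (fun=> setT); split; first by move=> i; rewrite in_fset0.
by apply/seteqP; split.
Qed.

Lemma finite_intersections_measurable J : finite_intersections J `<=` measurable.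
Proof.
move=> _ [K [A [KA ->]]]; rewrite bigcap_fset.
rewrite big_seq; apply: bigsetI_measurable => i iK.
by have [_ /Gm] := KA i iK.
Qed.

(** Both sides are finite measures in B that agree on a pi-system, hence on the
    sigma-algebra it generates. *)
Lemma finite_intersections_indep J i B C : ~ J i ->
  <<s finite_intersections J >> B -> G i C ->
  P (B `&` C) = (P B * P C)%E.
Proof.
move=> Ji sB GC; have mC := Gm GC.
have PC0 : 0 <= fine (P C) by rewrite fine_ge0.
pose r : {nonneg R} := NngNum PC0.
have PCE : P C = (r%:num)%:E by rewrite /= fineK// fin_num_measure.
have -> : P (B `&` C) = mrestr P mC B by [].
rewrite muleC PCE -[RHS]/(mscale r P B).
apply: (g_sigma_algebra_measure_unique (finite_intersections J) _ (fun=> setT)) => //.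
- exact: finite_intersections_measurable.
- by move=> _; exact: finite_intersections_setT.
- by rewrite bigcup_const//; exists 0%N.
- exact: finite_intersectionsI.
- move=> _ [K [A [KA ->]]].
  rewrite -[LHS]/(P (_ `&` C)) -[RHS]/((r%:num)%:E * P _)%E -PCE.
  have iK : i \notin K by apply/negP => /KA[].
  pose A' j := if j == i then C else A j.
  have KA' : forall j, j \in (i |` K)%fset -> G j (A' j).
    move=> j; rewrite in_fset1U /A'; case: eqVneq => [->//|_ /= /KA[]//].
  have A'K j : j \in K -> A' j = A j.
    by rewrite /A'; case: eqVneq => // ->; rewrite (negbTE iK).
  have := ind KA'; rewrite big_fsetU1//= {2}/A' eqxx.
  rewrite (eq_big_seq (fun j => P (A j))); last by move=> j jK; rewrite A'K.
  rewrite -(ind (fun j jK => (KA j jK).2)) => <-; congr (P _).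
  apply/seteqP; split => w.
    move=> [wA wC] j /=; rewrite in_fset1U /A'; case: eqVneq => //= _; exact: wA.
  move=> wA; split; last by move: (wA i); rewrite /= in_fset1U eqxx /A' eqxx => /(_ isT).
  by move=> j /= jK; move: (wA j); rewrite /= in_fset1U jK orbT A'K// => /(_ isT).
- by move=> _; rewrite /mrestr (le_lt_trans (probability_le1 _ _)) ?ltry//; exact: measurableI.
Qed.

End FiniteIntersections.

(** * Measurability of random vectors and of the oracle *)

Section MeasurableVectors.
Context (R : realType) (d : nat).

(** Coordinatewise measurability, which is how the oracle's measurability is
    given. *)
Definition measurable_vec dT (T : measurableType dT) (f : T -> 'rV[R]_d) :=
  forall j, measurable_fun [set: T] (fun w => f w 0 j).

Context dT (T : measurableType dT).
Implicit Types (f g : T -> 'rV[R]_d).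

Lemma measurable_vec_cst (x : 'rV[R]_d) : measurable_vec (fun _ : T => x).
Proof. by move=> j; exact: measurable_cst. Qed.

Lemma measurable_vecD f g : measurable_vec f -> measurable_vec g ->
  measurable_vec (fun w => f w + g w).
Proof.
by move=> mf mg j; under eq_fun do rewrite mxE; exact: measurable_funD.
Qed.

Lemma measurable_vecB f g : measurable_vec f -> measurable_vec g ->
  measurable_vec (fun w => f w - g w).
Proof.
move=> mf mg j; under eq_fun do rewrite !mxE.
by apply: measurable_funB.
Qed.

Lemma measurable_vecZ (c : T -> R) f : measurable_fun setT c ->
  measurable_vec f -> measurable_vec (fun w => c w *: f w).
Proof.
by move=> mc mf j; under eq_fun do rewrite mxE; exact: measurable_funM.
Qed.

Lemma measurable_vec_sum n (f : nat -> T -> 'rV[R]_d) :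
  (forall i, measurable_vec (f i)) ->
  measurable_vec (fun w => \sum_(i < n) f i w).
Proof.
move=> mf j; under eq_fun do rewrite summxE.
by apply: measurable_sum => i; exact: mf.
Qed.

(** Used for batches whose size is random: on each of the countably many events
    N = n the function is one of the f n. *)
Lemma measurable_fun_nat_index dU (U : measurableType dU) (N : T -> nat)
    (f : nat -> T -> U) :
  measurable_fun setT N -> (forall n, measurable_fun setT (f n)) ->
  measurable_fun setT (fun w => f (N w) w).
Proof.
move=> mN mf _ B mB.
have -> : [set: T] `&` (fun w => f (N w) w) @^-1` B =
    \bigcup_n ((setT `&` N @^-1` [set n]) `&` (setT `&` f n @^-1` B)).
  apply/seteqP; split => w /=.
    by move=> [_ wB]; exists (N w).
  by move=> [n _ [[_ /= <-] [_ wB]]].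
apply: bigcupT_measurable => n; apply: measurableI.
  by apply: mN => //.
by apply: mf.
Qed.

Lemma measurable_vec_batch_mean (N : T -> nat) (f : nat -> T -> 'rV[R]_d) :
  measurable_fun setT N -> (forall i, measurable_vec (f i)) ->
  measurable_vec (fun w => batch_mean (N w) (fun i => f i w)).
Proof.
move=> mN mf j.
apply: (@measurable_fun_nat_index _ _ N (fun n w => batch_mean n (f ^~ w) 0 j)) => // n.
by apply: measurable_vecZ; [exact: measurable_cst|exact: measurable_vec_sum].
Qed.

Lemma measurable_vec_if (c : T -> bool) f g : measurable_fun setT c ->
  measurable_vec f -> measurable_vec g ->
  measurable_vec (fun w => if c w then f w else g w).
Proof.
move=> mc mf mg j.
rewrite (_ : (fun w => _) = fun w => if c w then f w 0 j else g w 0 j).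
  exact: measurable_fun_ifT.
by apply/funext => w; case: (c w).
Qed.

Lemma dot_coord (dot : {dot 'rV[R]_d for idfun}) x y :
  dot x y = \sum_j y 0 j * dot x (delta_mx 0 j).
Proof.
rewrite {1}(row_sum_delta y) linear_sum /=.
by apply: eq_bigr => j _; rewrite dotZr.
Qed.

Lemma measurable_dot (dot : {dot 'rV[R]_d for idfun}) f g :
  measurable_vec f -> measurable_vec g ->
  measurable_fun setT (fun w => dot (f w) (g w)).
Proof.
move=> mf mg; under eq_fun do rewrite dot_coord.
apply: measurable_sum => j; apply: measurable_funM => //.
under eq_fun do rewrite dotC dot_coord.
by apply: measurable_sum => i; apply: measurable_funM.
Qed.

(** The bridge between row vectors and the tuples on which the oracle is assumed
    measurable. *)
Definition tuple_of_rV (x : 'rV[R]_d) : d.-tuple R := [tuple x 0 i | i < d].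

Lemma row_tuple_of_rV x : \row_i tnth (tuple_of_rV x) i = x.
Proof. by apply/rowP => i; rewrite mxE tnth_mktuple. Qed.

Lemma measurable_tuple_of_rV f : measurable_vec f ->
  measurable_fun setT (fun w => tuple_of_rV (f w)).
Proof.
move=> mf; apply/measurable_fun_tnthP => i.
rewrite (_ : _ \o _ = fun w => f w 0 i)//.
by apply/funext => w /=; rewrite tnth_mktuple.
Qed.

End MeasurableVectors.

Lemma measurable_vec_comp (R : realType) (d : nat) d1 d2 (T1 : measurableType d1)
    (T2 : measurableType d2) (f : T2 -> 'rV[R]_d) (g : T1 -> T2) :
  measurable_vec f -> measurable_fun setT g -> measurable_vec (f \o g).
Proof. by move=> mf mg j; apply: measurableT_comp (mf j) mg. Qed.

Section Oracle.
Context (R : realType) (d : nat) (dot : {dot 'rV[R]_d for idfun})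
  (F : 'rV[R]_d -> 'rV[R]_d) (dZ : measure_display) (Z : measurableType dZ)
  (Pz : probability Z R) (Fhat : 'rV[R]_d -> Z -> 'rV[R]_d) (sigma L : R).
Hypothesis oracle : stochastic_oracle dot F Pz Fhat sigma L.

Lemma measurable_oracle dT (T : measurableType dT) (v : T -> 'rV[R]_d)
    (y : T -> Z) : measurable_vec v -> measurable_fun setT y ->
  measurable_vec (fun w => Fhat (v w) (y w)).
Proof.
move=> mv my j.
have mt := measurable_fun_pair (measurable_tuple_of_rV mv) my.
have := measurableT_comp (oracle_measurable oracle j) mt.
by rewrite (_ : _ \o _ = fun w => Fhat (v w) (y w) 0 j)//; apply/funext => w /=;
  rewrite row_tuple_of_rV.
Qed.

(** F is the mean of the oracle, so its measurability follows from Tonelli's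
    theorem applied to the positive and negative parts. *)
Lemma measurable_oracle_mean dT (T : measurableType dT) (v : T -> 'rV[R]_d) :
  measurable_vec v -> measurable_vec (fun w => F (v w)).
Proof.
move=> mv j; apply/measurable_EFinP.
pose f (p : T * Z) := (Fhat (v p.1) p.2 0 j)%:E.
have mf : measurable_fun [set: T * Z] f.
  apply/measurable_EFinP.
  apply: (@measurable_oracle _ (T * Z)%type (fun p => v p.1) (fun p => p.2)).
    by apply: (measurable_vec_comp mv); exact: measurable_fst.
  exact: measurable_snd.
have -> : EFin \o (fun w => F (v w) 0 j) =
    (fun w => (\int[Pz]_y f^\+ (w, y) - \int[Pz]_y f^\- (w, y))%E).
  apply/funext => w /=; rewrite -(oracle_unbiased oracle) unlock.
  by rewrite [LHS]integralE; congr (_ - _)%E; apply: eq_integral => y _; rewrite unlock.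
apply: emeasurable_funB.
  have mp := measurable_funepos mf.
  exact: (measurable_fun_fubini_tonelli_F (m2 := Pz) _ mp (funepos_ge0 f)).
have mn := measurable_funeneg mf.
exact: (measurable_fun_fubini_tonelli_F (m2 := Pz) _ mn (funeneg_ge0 f)).
Qed.

Lemma measurable_oracle_at x : measurable_vec (Fhat x).
Proof.
by apply: (@measurable_oracle _ Z (fun=> x) id) => //; exact: measurable_vec_cst.
Qed.

End Oracle.

(** * Second moments of centred vectors *)

Section CenteredVector.
Context (R : realType) (d : nat) (dot : {dot 'rV[R]_d for idfun})
  (dZ : measure_display) (Z : measurableType dZ) (Q : probability Z R).

(** An expectation that is a finite number forces integrability, as the integral
    is the difference of those of the positive and negative parts. *)
Lemma integrable_expectation (f : Z -> R) (m : R) : measurable_fun setT f ->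
  ('E_Q[f])%E = m%:E -> Q.-integrable setT (EFin \o f).
Proof.
move=> mf; rewrite unlock => fm; apply/integrableP; split.
  exact/measurable_EFinP.
by rewrite integral_fin_num_abs//= fm.
Qed.

Lemma expectation_subC (f : Z -> R) (m : R) : measurable_fun setT f ->
  ('E_Q[f])%E = m%:E -> ('E_Q[fun y => (f y - m)%R])%E = 0%:E.
Proof.
move=> mf fm; have fi := integrable_expectation mf fm.
move: fm; rewrite unlock => fm.
under eq_integral do rewrite EFinB.
rewrite integralB_EFin//; last exact: finite_measure_integrable_cst.
by rewrite fm integral_cst//= probability_setT mule1 subee.
Qed.

Variable x : Z -> 'rV[R]_d.
Hypotheses (mx : measurable_vec x) (x_mean0 : forall j, ('E_Q[fun y => (x y 0 j)%R])%E = 0%:E)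
  (x_sqr : (\int[Q]_y (dot (x y) (x y))%:E < +oo)%E).

(** The cross term vanishes in mean: a centred vector adds only its second
    moment. *)
Lemma integral_sqr_shift (s : 'rV[R]_d) (c : R) :
  (\int[Q]_y (dot (s + c *: x y) (s + c *: x y))%:E =
   (dot s s)%:E + (c ^+ 2)%:E * \int[Q]_y (dot (x y) (x y))%:E)%E.
Proof.
pose q y := dot s (x y); pose r y := dot (x y) (x y).
have mr : measurable_fun setT r by exact: measurable_dot.
have ri : Q.-integrable setT (EFin \o r).
  apply/integrableP; split; first exact/measurable_EFinP.
  by under eq_integral do rewrite /= ger0_norm ?dot_ge0//.
have xi j : Q.-integrable setT (fun y => (x y 0 j * dot s (delta_mx 0 j))%:E).
  under eq_fun do rewrite mulrC EFinM.
  by apply: integrableZl => //; apply: integrable_expectation (x_mean0 j); exact: mx.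
have qE y : (q y)%:E = (\sum_j (x y 0 j * dot s (delta_mx 0 j))%:E)%E.
  by rewrite /q dot_coord sumEFin.
have qi : Q.-integrable setT (EFin \o q).
  rewrite (_ : _ \o _ = fun y => (q y)%:E)//; under eq_fun do rewrite qE.
  exact: integrable_sum.
have q0 : (\int[Q]_y (q y)%:E = 0)%E.
  under eq_integral do rewrite qE.
  rewrite integral_sum// big1// => j _.
  under eq_integral do rewrite mulrC EFinM.
  rewrite integralZl//; last by apply: integrable_expectation (x_mean0 j); exact: mx.
  by have := x_mean0 j; rewrite unlock => ->; rewrite mule0.
have eE y : (dot (s + c *: x y) (s + c *: x y))%:E
   = ((dot s s)%:E + ((2 * c)%:E * (q y)%:E + (c ^+ 2)%:E * (r y)%:E))%E.
  by rewrite -!EFinM -!EFinD /q /r !dotE (dotC dot (x y) s); congr _%:E; ring.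
under eq_integral do rewrite eE.
have i1 : Q.-integrable setT (fun y => (2 * c)%:E * (q y)%:E)%E by exact: integrableZl.
have i2 : Q.-integrable setT (fun y => (c ^+ 2)%:E * (r y)%:E)%E by exact: integrableZl.
rewrite integralD//=; [|exact: finite_measure_integrable_cst|exact: integrableD].
rewrite integralD// !integralZl// q0 mule0 add0e.
by rewrite integral_cst//= probability_setT mule1.
Qed.

End CenteredVector.

Section OracleNoise.
Context (R : realType) (d : nat) (dot : {dot 'rV[R]_d for idfun})
  (F : 'rV[R]_d -> 'rV[R]_d) (dZ : measure_display) (Z : measurableType dZ)
  (Pz : probability Z R) (Fhat : 'rV[R]_d -> Z -> 'rV[R]_d) (sigma L : R).
Hypothesis oracle : stochastic_oracle dot F Pz Fhat sigma L.

Lemma oracle_noise_mean0 x j : ('E_Pz[fun y => ((Fhat x y - F x) 0 j)%R])%E = 0%:E.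
Proof.
rewrite -(expectation_subC (measurable_oracle_at oracle x j)
  (oracle_unbiased oracle x j)).
by congr expectation; apply/funext => y; rewrite !mxE.
Qed.

Lemma oracle_noise_sqr x :
  (\int[Pz]_y (dot (Fhat x y - F x) (Fhat x y - F x))%:E <= (sigma ^+ 2)%:E)%E.
Proof.
have := oracle_variance oracle x; rewrite unlock.
by under eq_integral do rewrite sqr_dot_norm.
Qed.

Lemma oracle_diff_noise_mean0 x x' j :
  ('E_Pz[fun y => ((Fhat x y - Fhat x' y - (F x - F x')) 0 j)%R])%E = 0%:E.
Proof.
have m := measurable_oracle_at oracle.
have i u := integrable_expectation (m u j) (oracle_unbiased oracle u j).
have := @expectation_subC _ _ _ Pz (fun y => Fhat x y 0 j - Fhat x' y 0 j)
  (F x 0 j - F x' 0 j).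
rewrite (_ : (fun y => _ - (F x 0 j - F x' 0 j)) = fun y =>
  (Fhat x y - Fhat x' y - (F x - F x')) 0 j); last first.
  by apply/funext => y; rewrite !mxE.
apply.
  by apply: measurable_funB; exact: m.
rewrite unlock; under eq_integral do rewrite EFinB.
rewrite integralB_EFin//.
by have := oracle_unbiased oracle x j; have := oracle_unbiased oracle x' j;
  rewrite unlock => -> ->.
Qed.

(** Centring a vector can only decrease its second moment. *)
Lemma oracle_diff_noise_sqr x x' :
  (\int[Pz]_y (dot (Fhat x y - Fhat x' y - (F x - F x'))
                   (Fhat x y - Fhat x' y - (F x - F x')))%:E
   <= (L ^+ 2 * dot (x - x') (x - x'))%:E)%E.
Proof.
have m := measurable_oracle_at oracle.
pose X y := Fhat x y - Fhat x' y; pose c := F x - F x'.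
have mX : measurable_vec X by exact: measurable_vecB.
have mXc : measurable_vec (fun y => X y - c).
  by apply: measurable_vecB => //; exact: measurable_vec_cst.
have Xsqr : (\int[Pz]_y (dot (X y) (X y))%:E
     <= (L ^+ 2 * dot (x - x') (x - x'))%:E)%E.
  have := oracle_lipschitz oracle x x'; rewrite unlock sqr_dot_norm.
  by under eq_integral do rewrite sqr_dot_norm.
have fin : (\int[Pz]_y (dot (X y - c) (X y - c))%:E < +oo)%E.
  apply: (@le_lt_trans _ _ (\int[Pz]_y (2%:E * (dot (X y) (X y))%:E + (2 * dot c c)%:E))%E).
    apply: ge0_le_integral_dominated => y; first by rewrite lee_fin dot_ge0.
    by rewrite -EFinM -EFinD lee_fin; have := dot_sqrD_le2 dot (X y) (- c);
      rewrite !dotNl !dotNr opprK.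
  rewrite ge0_integralD//; first last.
  - by move=> y _; rewrite lee_fin mulr_ge0 ?dot_ge0.
  - by apply: emeasurable_funM => //; apply/measurable_EFinP; exact: measurable_dot.
  - by move=> y _; rewrite -EFinM lee_fin mulr_ge0 ?dot_ge0.
  rewrite ge0_integralZl//; first last.
  - by move=> y _; rewrite lee_fin dot_ge0.
  - by apply/measurable_EFinP; exact: measurable_dot.
  rewrite integral_cst//= probability_setT mule1 lte_add_pinfty ?ltry//.
  by rewrite lte_mul_pinfty//; apply: le_lt_trans Xsqr _; rewrite ltry.
have := integral_sqr_shift mXc (oracle_diff_noise_mean0 x x') fin c 1.
rewrite expr1n mul1e => eqX; apply: le_trans Xsqr.
apply: (@le_trans _ _ (\int[Pz]_y (dot (c + 1 *: (X y - c)) (c + 1 *: (X y - c)))%:E)%E).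
  by rewrite eqX leeDr// lee_fin dot_ge0.
by under eq_integral do rewrite scale1r addrC subrK.
Qed.

End OracleNoise.

(** * Random batches of independent samples *)

Section History.
Context (R : realType) (dO : measure_display) (Omega : measurableType dO)
  (P : probability Omega R) (I : choiceType) (G : I -> set (set Omega)).
Hypotheses (Gm : forall i, G i `<=` measurable) (GI : forall i, setI_closed (G i))
  (GT : forall i, G i setT) (ind : mutually_independent P G).

(** The sample space carrying only the information of the sources in J.  The
    carrier is still Omega, so a run of the algorithm can be regarded as a
    function of its history by changing the sigma-algebra alone. *)
Definition history (J : set I) := g_sigma_algebraType (finite_intersections G J).

Lemma measurable_history J : measurable_fun [set: Omega] (id : Omega -> history J).
Proof.
move=> _ B mB; rewrite setTI.
apply: (smallest_sub (@sigma_algebra_measurable _ Omega) _ mB).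
exact: finite_intersections_measurable.
Qed.

Lemma sub_history J J' : J `<=` J' ->
  measurable_fun [set: history J'] (id : history J' -> history J).
Proof.
move=> JJ' _ B mB; rewrite setTI.
apply: (smallest_sub (@sigma_algebra_measurable _ (history J')) _ mB).
move=> _ [K [A [KA ->]]]; apply: sub_gen_smallest.
by exists K, A; split=> // i /KA[Ji GA]; split=> //; exact: JJ'.
Qed.

Lemma history_coord J i dT (T : measurableType dT) (X : Omega -> T) : J i ->
  G i = preimage_set_system setT X measurable ->
  measurable_fun [set: history J] (X : history J -> T).
Proof.
move=> Ji GX _ B mB; rewrite setTI; apply: sub_gen_smallest.
exists [fset i]%fset, (fun=> X @^-1` B); split.
  move=> j; rewrite in_fset1 => /eqP ->; split=> //; rewrite GX.
  by exists B => //; rewrite setTI.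
by apply/seteqP; split => [w wB j //|w /(_ i)]; apply; rewrite /= in_fset1.
Qed.

Section OneSample.
Context (J : set I) (i : I) (dZ : measure_display) (Z : measurableType dZ)
  (Y : {mfun Omega >-> Z}) .
Hypotheses (Ji : ~ J i) (GY : G i = preimage_set_system setT Y measurable).

(** A source outside J can be integrated out with the history frozen. *)
Lemma history_tonelli (f : history J * Z -> \bar R) :
  measurable_fun [set: history J * Z] f -> (forall p, 0 <= f p)%E ->
  (\int[P]_w f (w, Y w) = \int[P]_w \int[distribution P Y]_y f (w, y))%E.
Proof.
pose X : {mfun Omega >-> history J} := HB.pack (id : Omega -> history J)
  (isMeasurableFun.Build _ _ _ _ _ (@measurable_history J)).
apply: (@independent_tonelli _ _ _ _ _ (history J) Z P X Y) => A B mA mB.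
apply: (finite_intersections_indep Gm GI GT ind Ji) => //.
by rewrite GY; exists B => //; rewrite setTI.
Qed.

End OneSample.

End History.

Section Batch.
Context (R : realType) (d : nat) (dot : {dot 'rV[R]_d for idfun})
  (dO : measure_display) (Omega : measurableType dO)
  (P : probability Omega R) (I : choiceType) (G : I -> set (set Omega)).
Hypotheses (Gm : forall i, G i `<=` measurable) (GI : forall i, setI_closed (G i))
  (GT : forall i, G i setT) (ind : mutually_independent P G).
Context (dZ : measure_display) (Z : measurableType dZ) (Pz : probability Z R).

(** One fresh centred sample, scaled by a coefficient known beforehand, adds at
    most its own second moment to the mean square of what was known before. *)
Lemma one_sample_sqr (J : set I) (i : I) (Y : {mfun Omega >-> Z})
    (s : history G J -> 'rV[R]_d) (c h : history G J -> R)
    (xi : history G J -> Z -> 'rV[R]_d) :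
  ~ J i -> G i = preimage_set_system setT Y measurable ->
  (forall A, measurable A -> distribution P Y A = Pz A) ->
  measurable_vec s -> measurable_fun setT c ->
  measurable_vec (fun p : history G J * Z => xi p.1 p.2) ->
  (forall w j, ('E_Pz[fun y => (xi w y 0 j)%R])%E = 0%:E) ->
  (forall w, (\int[Pz]_y (dot (xi w y) (xi w y))%:E <= (h w)%:E)%E) ->
  (\int[P]_w (dot (s w + c w *: xi w (Y w)) (s w + c w *: xi w (Y w)))%:E
   <= \int[P]_w (dot (s w) (s w) + c w ^+ 2 * h w)%:E)%E.
Proof.
move=> Ji GY YPz ms mc mxi xi0 xih.
pose v (p : history G J * Z) := s p.1 + c p.1 *: xi p.1 p.2.
have mv : measurable_vec v.
  apply: measurable_vecD; first exact: measurable_vec_comp ms measurable_fst.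
  apply: measurable_vecZ => //.
  exact: measurableT_comp mc measurable_fst.
have mf : measurable_fun [set: history G J * Z] (fun p => (dot (v p) (v p))%:E).
  by apply/measurable_EFinP; exact: measurable_dot.
rewrite (history_tonelli Gm GI GT ind Ji GY mf); last first.
  by move=> p; rewrite lee_fin dot_ge0.
apply: ge0_le_integral_dominated => w.
  by apply: integral_ge0 => y _; rewrite lee_fin dot_ge0.
rewrite (eq_measure_integral Pz) => [|A mA _]; last exact: YPz.
have mx : measurable_vec (xi w).
  move=> j; have := measurableT_comp (mxi j) (measurable_fun_pair
    (@measurable_cst _ _ Z (history G J) setT w) (@measurable_id _ Z setT)).
  by [].
have fin : (\int[Pz]_y (dot (xi w y) (xi w y))%:E < +oo)%E.
  by apply: le_lt_trans (xih w) _; rewrite ltry.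
rewrite /v /= integral_sqr_shift//.
rewrite EFinD leeD2lE// [leRHS]EFinM.
by apply: lee_pmul; rewrite ?lee_fin ?sqr_ge0 ?lexx//;
  apply: integral_ge0 => y _; rewrite lee_fin dot_ge0.
Qed.

Lemma limn_einf_le (u : (\bar R)^nat) (b : \bar R) :
  (forall n, u n <= b)%E -> (limn_einf u <= b)%E.
Proof.
move=> ub; rewrite limn_einf_lim; apply: lime_le; first exact: is_cvg_einfs.
apply: nearW => n; apply: le_trans (ub n); apply: ereal_inf_lbound.
by exists n => /=.
Qed.

Lemma sum_truncated m n (a : R) :
  \sum_(i < m) (if (i < n)%N then a else 0) = a *+ minn m n.
Proof.
elim: m => [|m IH]; first by rewrite big_ord0 min0n mulr0n.
rewrite big_ord_recr /= IH; have [mn|nm] := ltnP m n.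
  by rewrite (minn_idPl mn) mulrSr.
by rewrite addr0 (minn_idPr _)// ltnW// ltnS.
Qed.

Section BatchMean.
Context (J0 : set I) (Y : nat -> {mfun Omega >-> Z}) (idx : nat -> I).
Hypotheses (idx_inj : injective idx) (idx_new : forall i, ~ J0 (idx i))
  (GY : forall i, G (idx i) = preimage_set_system setT (Y i) measurable)
  (YPz : forall i A, measurable A -> distribution P (Y i) A = Pz A).
Context (D : history G J0 -> 'rV[R]_d) (N : history G J0 -> nat)
  (h : history G J0 -> R) (xi : history G J0 -> Z -> 'rV[R]_d).
Hypotheses (mD : measurable_vec D) (mN : measurable_fun setT N)
  (mh : measurable_fun setT h) (h0 : forall w, 0 <= h w)
  (mxi : measurable_vec (fun p : history G J0 * Z => xi p.1 p.2))
  (xi0 : forall w j, ('E_Pz[fun y => (xi w y 0 j)%R])%E = 0%:E)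
  (xih : forall w, (\int[Pz]_y (dot (xi w y) (xi w y))%:E <= (h w)%:E)%E).

Let J m := J0 `|` [set idx i | i in `I_m].

(* The m-th sample enters with weight 1 / N only if the batch is long enough. *)
Let coef m w : R := if (m < N w)%N then (N w)%:R^-1 else 0.

(* The partial sum after m samples, equal to the full one as soon as N <= m. *)
Let T m w := D w + \sum_(i < m) coef i w *: xi w (Y i w).

Let mid m : measurable_fun [set: history G (J m)]
  (id : history G (J m) -> history G J0).
Proof. by apply: sub_history => i; left. Qed.

Let mcoef m : measurable_fun [set: history G J0] (coef m).
Proof.
apply: measurable_fun_ifT => //.
  by apply: measurable_fun_ltn => //; exact: measurable_cst.
have mV : measurable_fun [set: nat] (fun n => n%:R^-1 : R) by [].
exact: measurableT_comp mV mN.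
Qed.

Let mT m : measurable_vec (T m : history G (J m) -> 'rV[R]_d).
Proof.
apply: measurable_vecD; first exact: (measurable_vec_comp mD (@mid m)).
move=> j; under eq_fun do rewrite summxE.
apply: measurable_sum => i; move: j; apply: measurable_vecZ.
  exact: measurableT_comp (@mcoef i) (@mid m).
have mY : measurable_fun [set: history G (J m)] (Y i : history G (J m) -> Z).
  by apply: (history_coord _ (GY i)); right; exists i => //=; exact: ltn_ord.
exact: (measurable_vec_comp mxi (measurable_fun_pair (@mid m) mY)).
Qed.

Let T_sqr m : (\int[P]_w (dot (T m w) (T m w))%:E <=
  \int[P]_w (dot (D w) (D w) + \sum_(i < m) coef i w ^+ 2 * h w)%:E)%E.
Proof.
have mcast d' (T' : measurableType d') k (f : history G (J k) -> T') :
  measurable_fun setT f -> measurable_fun [set: Omega] f.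
  by move=> mf; apply: measurableT_comp mf (measurable_history Gm (J:=J k)).
have mcast0 d' (T' : measurableType d') (f : history G J0 -> T') :
  measurable_fun setT f -> measurable_fun [set: Omega] f.
  by move=> mf; apply: measurableT_comp mf (measurable_history Gm (J:=J0)).
elim: m => [|m IH].
  apply: ge0_le_integral_dominated => w; first by rewrite lee_fin dot_ge0.
  by rewrite /T !big_ord0 !addr0.
have TE w : T m.+1 w = T m w + coef m w *: xi w (Y m w).
  by rewrite /T big_ord_recr addrA.
under eq_integral do rewrite TE.
have Jm : ~ J m (idx m).
  by case=> [/idx_new//|[i /= im /idx_inj]] ii; rewrite ii ltnn in im.
apply: le_trans (@one_sample_sqr (J m) _ (Y m) (T m) (coef m) h xi Jm (GY m)
  (YPz m) (@mT m) _ _ xi0 xih) _.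
- exact: measurableT_comp (@mcoef m) (@mid m).
- exact: (measurable_vec_comp mxi (measurable_fun_pair
    (measurableT_comp (@mid m) measurable_fst) measurable_snd)).
under eq_integral do rewrite EFinD.
have mc2 k : measurable_fun [set: Omega] (fun w => coef k w ^+ 2 * h w).
  by apply: measurable_funM; [apply/measurable_funX/mcast0|exact: mcast0].
have mDD : measurable_fun [set: Omega] (fun w => dot (D w) (D w)).
  exact: (mcast0 _ _ _ (measurable_dot dot mD mD)).
have mTT : measurable_fun [set: Omega] (fun w => dot (T m w) (T m w)).
  exact: (mcast _ _ _ _ (measurable_dot dot (@mT m) (@mT m))).
rewrite ge0_integralD//; first last.
- by apply/measurable_EFinP.
- by move=> w _; rewrite lee_fin mulr_ge0 ?sqr_ge0.
- by apply/measurable_EFinP.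
- by move=> w _; rewrite lee_fin dot_ge0.
under [leRHS]eq_integral do rewrite big_ord_recr addrA EFinD.
rewrite [leRHS]ge0_integralD//; first last.
- by apply/measurable_EFinP.
- by move=> w _; rewrite lee_fin mulr_ge0 ?sqr_ge0.
- apply/measurable_EFinP; apply: measurable_funD => //.
  by apply: measurable_sum => i; exact: mc2.
- move=> w _; rewrite lee_fin addr_ge0 ?dot_ge0// sumr_ge0// => i _.
  by rewrite mulr_ge0 ?sqr_ge0.
by apply: leeD.
Qed.

(** Variance of the mean of a batch whose size N is itself random but known before
    the batch is drawn.  When N w = 0 the mean and h w / N w both vanish. *)
Lemma batch_mean_sqr :
  (\int[P]_w (dot (D w + batch_mean (N w) (fun i => xi w (Y i w)))
                  (D w + batch_mean (N w) (fun i => xi w (Y i w))))%:E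
   <= \int[P]_w (dot (D w) (D w) + h w / (N w)%:R)%:E)%E.
Proof.
pose u m w := (dot (T m w) (T m w))%:E.
have lim w : limn_einf (u ^~ w) = (dot (D w + batch_mean (N w) (fun i => xi w (Y i w)))
    (D w + batch_mean (N w) (fun i => xi w (Y i w))))%:E.
  have [//|-> _ //] := @cvg_limn_einf_sup _ (u ^~ w) (dot (D w + batch_mean (N w) (fun i => xi w (Y i w)))
    (D w + batch_mean (N w) (fun i => xi w (Y i w))))%:E _.
  apply: cvg_near_cst; exists (N w) => // m /= Nm.
  rewrite /u /T; have -> // : \sum_(i < m) coef i w *: xi w (Y i w) =
     batch_mean (N w) (fun i => xi w (Y i w)).
  rewrite /batch_mean scaler_sumr (big_ord_widen _ (fun i => (N w)%:R^-1 *: xi w (Y i w)) Nm).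
  rewrite [RHS]big_mkcond; apply: eq_bigr => i _; rewrite /coef.
  by case: ifPn => // _; rewrite scale0r.
under eq_integral do rewrite -lim.
apply: le_trans (fatou _ _ _ _) _ => //.
- move=> m; apply/measurable_EFinP.
  exact: (measurableT_comp (measurable_dot dot (@mT m) (@mT m))
    (measurable_history Gm (J:=J m))).
- by move=> m w _; rewrite lee_fin dot_ge0.
apply: limn_einf_le => m; apply: le_trans (T_sqr m) _.
apply: ge0_le_integral_dominated => w; rewrite lee_fin.
  by rewrite addr_ge0 ?dot_ge0// sumr_ge0// => i _; rewrite mulr_ge0 ?sqr_ge0.
rewrite lerD2l -mulr_suml mulrC ler_wpM2l//.
under eq_bigr do rewrite /coef (fun_if (fun a => a ^+ 2)) expr0n /=.
rewrite sum_truncated; have [->|N0] := posnP (N w).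
  by rewrite minn0 mulr0n invr0.
have n0 : 0 < (N w)%:R :> R by rewrite ltr0n.
rewrite -[leLHS]mulr_natr expr2 -mulrA ler_piMr ?invr_ge0 ?(ltW n0)//.
by rewrite mulrC ler_pdivrMr// mul1r ler_nat geq_minr.
Qed.

End BatchMean.

End Batch.

(** * Batch sizes and coins *)

Section BatchSizes.
Context (R : realType).
Implicit Types (x p eps sigma L : R).

Lemma ceiln_ge x : 0 <= x -> x <= (ceiln x)%:R.
Proof.
move=> x0; have c0 : 0 <= Num.ceil x by rewrite ceil_ge0; lra.
have /andP[_] := ceil_itv x; by rewrite /ceiln -[X in X%:~R](gez0_abs c0).
Qed.

Lemma ceiln_le x : 0 <= x -> (ceiln x)%:R <= x + 1.
Proof.
move=> x0; have c0 : 0 <= Num.ceil x by rewrite ceil_ge0; lra.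
have /andP[+ _] := ceil_itv x; rewrite /ceiln -[X in (X - 1)%:~R](gez0_abs c0).
by rewrite intrB /= -pmulrn => ?; lra.
Qed.

Lemma measurable_ceiln : measurable_fun [set: R] (@ceiln R).
Proof.
move=> _ B _; rewrite setTI.
have -> : @ceiln R @^-1` B = \bigcup_(k in [set k : int | B `|k|%N])
    `](k - 1)%:~R, k%:~R]%classic.
  apply/seteqP; split => x /=.
    move=> Bx; exists (Num.ceil x) => //=; rewrite in_itv /=; exact: ceil_itv.
  move=> [k Bk]; rewrite /= in_itv /= => kx.
  by rewrite /ceiln (_ : Num.ceil x = k)//; apply/eqP; rewrite ceil_eq.
rewrite bigcup_mkcond; apply: countable_bigcupT_measurable => // k.
by case: ifP => _; [exact: measurable_itv|exact: measurable0].
Qed.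

Lemma batch1_gt0 sigma eps p : (0 < batch1 sigma eps p)%N.
Proof. by rewrite /batch1 leq_max. Qed.

Lemma batch1_variance sigma eps p : 0 < eps -> 0 < p ->
  sigma ^+ 2 / (batch1 sigma eps p)%:R <= p * eps ^+ 2 / 8.
Proof.
move=> e0 p0; set n := batch1 _ _ _.
have n0 : 0 < n%:R :> R by rewrite ltr0n batch1_gt0.
have pe : 0 < p * eps ^+ 2 by rewrite mulr_gt0 ?exprn_gt0.
have : 8 * sigma ^+ 2 / (p * eps ^+ 2) <= n%:R.
  apply: le_trans (ceiln_ge _) _; last by rewrite ler_nat leq_maxr.
  by rewrite divr_ge0 ?(ltW pe)// pmulr_rge0 ?sqr_ge0.
rewrite ler_pdivrMr// => H; rewrite ler_pdivrMr//; lra.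
Qed.

Lemma batch1_le sigma eps p : 0 < eps -> 0 < p ->
  (batch1 sigma eps p)%:R <= 8 * sigma ^+ 2 / (p * eps ^+ 2) + 1.
Proof.
move=> e0 p0.
have x0 : 0 <= 8 * sigma ^+ 2 / (p * eps ^+ 2).
  have pe : 0 < p * eps ^+ 2 by rewrite mulr_gt0 ?exprn_gt0.
  by rewrite divr_ge0 ?(ltW pe)// pmulr_rge0 ?sqr_ge0.
rewrite /batch1 natr_max ge_max ceiln_le// andbT; lra.
Qed.

Lemma coin_prob_gt0 j : 0 < coin_prob R j.
Proof. by rewrite lt_min divr_gt0/=. Qed.

Lemma coin_prob_le1 j : coin_prob R j <= 1.
Proof. by rewrite ge_min lexx orbT. Qed.

Lemma coin_prob_ge j : j.+1%:R^-1 <= coin_prob R j.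
Proof.
rewrite le_min invf_le1 ?ltr0n// ler1n andbT -[leLHS]mul1r ler_pM2r ?invr_gt0//; lra.
Qed.

Section Batch2.
Context (d : nat) (dot : {dot 'rV[R]_d for idfun}).
Implicit Types v : 'rV[R]_d.

Lemma batch2_arg_ge0 L eps p v v' :
  0 <= 8 * L ^+ 2 * dot_norm dot (v - v') ^+ 2 / (p ^+ 2 * eps ^+ 2).
Proof.
apply: divr_ge0; last by rewrite -exprMn sqr_ge0.
by rewrite -mulrA -exprMn pmulr_rge0 ?sqr_ge0.
Qed.

Lemma batch2_variance L eps p v v' : 0 < eps -> 0 < p ->
  L ^+ 2 * dot (v - v') (v - v') / (batch2 dot L eps p v v')%:R
  <= p ^+ 2 * eps ^+ 2 / 8.
Proof.
move=> e0 p0; set n := batch2 _ _ _ _ _ _.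
have pe : 0 < p ^+ 2 * eps ^+ 2 by rewrite mulr_gt0 ?exprn_gt0.
have [->|n0] := posnP n; first by rewrite invr0 mulr0 divr_ge0 ?(ltW pe).
have {}n0 : 0 < n%:R :> R by rewrite ltr0n.
have := ceiln_ge (batch2_arg_ge0 L eps p v v').
rewrite -/(batch2 dot L eps p v v') -/n sqr_dot_norm.
rewrite ler_pdivrMr// => H; rewrite ler_pdivrMr//; lra.
Qed.

Lemma batch2_le L eps p v v' :
  (batch2 dot L eps p v v')%:R <=
    8 * L ^+ 2 * dot (v - v') (v - v') / (p ^+ 2 * eps ^+ 2) + 1.
Proof.
by rewrite -sqr_dot_norm; exact: ceiln_le (batch2_arg_ge0 _ _ _ _ _).
Qed.

(** An empty correction batch is drawn only when the point has not moved, and then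
    the absent correction is exact. *)
Lemma batch2_eq0 L eps p v v' : 0 < eps -> 0 < p -> 0 < L ->
  batch2 dot L eps p v v' = 0%N -> v = v'.
Proof.
move=> e0 p0 L0 n0; have pe : 0 < p ^+ 2 * eps ^+ 2 by rewrite mulr_gt0 ?exprn_gt0.
have := ceiln_ge (batch2_arg_ge0 L eps p v v').
rewrite -/(batch2 dot L eps p v v') n0 sqr_dot_norm ler_pdivrMr// mul0r.
rewrite pmulr_rle0 ?mulr_gt0 ?exprn_gt0// => le0.
by apply/subr0_eq/(@dot_eq0 _ _ dot)/eqP; rewrite eq_le le0 dot_ge0.
Qed.

End Batch2.

Lemma batch_mean_shift d n (f : nat -> 'rV[R]_d) c : (0 < n)%N ->
  batch_mean n (fun i => f i - c) = batch_mean n f - c.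
Proof.
move=> n0; rewrite /batch_mean big_split /= sumr_const card_ord scalerDr.
by rewrite -(scaler_nat n (- c)) scalerA mulVf ?scale1r// pnatr_eq0 -lt0n.
Qed.

Lemma batch_mean0 d (f : nat -> 'rV[R]_d) : batch_mean 0 f = 0.
Proof. by rewrite /batch_mean big_ord0 scaler0. Qed.

End BatchSizes.

Lemma integral_bool (R : realType) (Q : probability bool R) (a b p : R) :
  0 <= a -> 0 <= b -> Q [set true] = p%:E ->
  (\int[Q]_y (if y then a else b)%:E = (p * a + (1 - p) * b)%:E)%E.
Proof.
move=> a0 b0 Qt.
have Qf : Q [set false] = (1 - p)%:E.
  rewrite EFinB -Qt -probability_setC//; congr (Q _).
  by apply/seteqP; split => -[]//= /(_ erefl).
have eE y : ((if y then a else b)%:E =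
   a%:E * (\1_[set true] y)%:E + b%:E * (\1_[set false] y)%:E)%E.
  have E (b1 b2 : bool) : (b1 \in [set b2]) = (b1 == b2).
    by apply/idP/eqP => [/set_mem//|->]; exact: mem_set.
  by case: y; rewrite !indicE !E /= ?mule1 ?mule0 ?adde0 ?add0e.
under eq_integral do rewrite eE.
rewrite ge0_integralD//; first last.
- by move=> y _; rewrite mule_ge0// lee_fin.
- by move=> y _; rewrite mule_ge0// lee_fin.
rewrite !ge0_integralZl ?lee_fin//.
rewrite !integral_indic// !setIT.
transitivity (a%:E * p%:E + b%:E * (1 - p)%:E)%E; first by congr (_ * _ + _ * _)%E.
by rewrite -!EFinM -EFinD; congr _%:E; ring.
Qed.

(** * Mean square error of the estimator *)

Section EstimatorError.
Context (R : realType) (d : nat) (dot : {dot 'rV[R]_d for idfun})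
  (F : 'rV[R]_d -> 'rV[R]_d) (sigma L e0 eps : R) (u0 : 'rV[R]_d)
  (dZ : measure_display) (Z : measurableType dZ) (Pz : probability Z R)
  (Fhat : 'rV[R]_d -> Z -> 'rV[R]_d)
  (dO : measure_display) (Omega : measurableType dO) (P : probability Omega R)
  (z : nat -> nat -> {RV P >-> Z}) (coin : nat -> {RV P >-> bool}).
Hypotheses (L0 : 0 < L) (eps0 : 0 < eps)
  (oracle : stochastic_oracle dot F Pz Fhat sigma L)
  (rnd : algorithm_randomness Pz z coin).

Local Notation state k w := (halpern dot Fhat sigma L e0 eps u0
  (fun b i => z b i w) (fun j => coin j w) k).
Local Notation err k w := (oracle_error dot F L e0 u0 Fhat sigma eps
  (fun b i => z b i w) (fun j => coin j w) k).

Let G (x : (nat * nat) + nat) : set (set Omega) := match x with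
  | inl bi => preimage_set_system setT (z bi.1 bi.2) measurable
  | inr j => preimage_set_system setT (coin j) measurable
  end.

Let preimage_measurable dT (T : measurableType dT) (X : {mfun Omega >-> T}) :
  preimage_set_system setT X measurable `<=` measurable.
Proof. by move=> _ [B mB <-]; exact: measurable_funP. Qed.

Let preimageI dT (T : measurableType dT) (X : {mfun Omega >-> T}) :
  setI_closed (preimage_set_system setT X measurable).
Proof.
move=> _ _ [B mB <-] [C mC <-]; exists (B `&` C); first exact: measurableI.
by rewrite !setTI.
Qed.

Let preimageT dT (T : measurableType dT) (X : {mfun Omega >-> T}) :
  preimage_set_system setT X measurable setT.
Proof. by exists setT => //; rewrite setTI preimage_setT. Qed.

Let Gm i : G i `<=` measurable.
Proof. by case: i => i; exact: preimage_measurable. Qed.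

Let GI i : setI_closed (G i).
Proof. by case: i => i; exact: preimageI. Qed.

Let GT i : G i setT.
Proof. by case: i => i; exact: preimageT. Qed.

Let ind : mutually_independent P G := sample_coin_independent rnd.

(** The sources that determine the state after k iterations: the batches of index
    at most k (index 0 being the initial one) and the first k coins. *)
Definition past k : set ((nat * nat) + nat) := [set x | match x with
  | inl bi => (bi.1 <= k)%N
  | inr j => (j < k)%N
  end].

(** The past together with the next batch, but not the next coin: both candidate
    estimates of the next step are functions of these. *)
Definition past_and_samples k : set ((nat * nat) + nat) := [set x | match x with
  | inl bi => (bi.1 <= k.+1)%N
  | inr j => (j < k)%N
  end].

Local Notation hist J := (history G J).

Let past_sub k : past k `<=` past_and_samples k.
Proof. by move=> [bi|j] //=; exact: leqW. Qed.

Let samples_sub k : past_and_samples k `<=` past k.+1.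
Proof. by move=> [bi|j] //=; exact: leqW. Qed.

(** The next query point is known before its batch is drawn. *)
Definition extrapolated k w := iter_v (state k.+1 w).

Definition fresh_estimate k w :=
  batch_mean (batch1 sigma eps (coin_prob R k))
    (fun i => Fhat (extrapolated k w) (z k.+1 i w)).

Definition corrected_estimate k w := iter_Ft (state k w) +
  batch_mean (batch2 dot L eps (coin_prob R k) (extrapolated k w) (iter_v (state k w)))
    (fun i => Fhat (extrapolated k w) (z k.+1 i w)
              - Fhat (iter_v (state k w)) (z k.+1 i w)).

Lemma iter_FtS k w : iter_Ft (state k.+1 w) =
  if coin k w then fresh_estimate k w else corrected_estimate k w.
Proof. by []. Qed.

Let measurable_state_at k := [/\
  measurable_vec (fun w : hist (past k) => iter_u (state k w)),
  measurable_vec (fun w : hist (past k) => iter_v (state k w)) &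
  measurable_vec (fun w : hist (past k) => iter_Ft (state k w))].

Let measurable_extrapolated k : measurable_state_at k ->
  measurable_vec (extrapolated k : hist (past k) -> _).
Proof.
move=> [mu mv mF].
have m : measurable_vec (fun w : hist (past k) => 1 / k.+2%:R *: u0 +
    k.+1%:R / k.+2%:R *: iter_u (state k w)
    - step_size (9 * L ^+ 2) e0 k *: iter_Ft (state k w)).
  apply: measurable_vecB; [apply: measurable_vecD|]; last by apply: measurable_vecZ.
    exact: measurable_vec_cst.
  exact: measurable_vecZ.
exact: m.
Qed.

Let measurable_sample k i : measurable_fun [set: hist (past_and_samples k)]
  (z k.+1 i : hist (past_and_samples k) -> Z).
Proof. by apply: (history_coord (G := G) (i := inl (k.+1, i))) => //=. Qed.

Let lift_past k (f : hist (past k) -> 'rV[R]_d) : measurable_vec f ->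
  measurable_vec (f : hist (past_and_samples k) -> 'rV[R]_d).
Proof.
move=> mf; exact: (measurable_vec_comp mf (sub_history (G := G) (@past_sub k))).
Qed.

Let measurable_fresh k : measurable_state_at k ->
  measurable_vec (fresh_estimate k : hist (past_and_samples k) -> _).
Proof.
move=> mS; have mv := lift_past (measurable_extrapolated mS).
apply: measurable_vec_batch_mean => [|i]; first exact: measurable_cst.
exact: measurable_oracle oracle _ _ _ _ mv (@measurable_sample k i).
Qed.

Let measurable_batch2 dT (T : measurableType dT) p (v v' : T -> 'rV[R]_d) :
  measurable_vec v -> measurable_vec v' ->
  measurable_fun setT (fun w => batch2 dot L eps p (v w) (v' w)).
Proof.
move=> mv mv'; rewrite /batch2; apply: measurableT_comp (@measurable_ceiln R) _.
apply: measurable_funM => //; apply: measurable_funM => //.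
under eq_fun do rewrite sqr_dot_norm.
by apply: measurable_dot; exact: measurable_vecB.
Qed.

Let measurable_corrected k : measurable_state_at k ->
  measurable_vec (corrected_estimate k : hist (past_and_samples k) -> _).
Proof.
move=> mS; have mv := lift_past (measurable_extrapolated mS).
case: mS => mu /lift_past mv' /lift_past mF.
apply: measurable_vecD => //; apply: measurable_vec_batch_mean => [|i].
  exact: measurable_batch2.
by apply: measurable_vecB; apply: (measurable_oracle oracle) => //;
  exact: measurable_sample.
Qed.

Let measurable_coin k : measurable_fun [set: hist (past k.+1)]
  (coin k : hist (past k.+1) -> bool).
Proof. by apply: (history_coord (G := G) (i := inr k)) => //=. Qed.

Lemma measurable_state k : measurable_state_at k.
Proof.
elim: k => [|k IH].
  split; [exact: measurable_vec_cst..|].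
  apply: measurable_vec_batch_mean => [|i]; first exact: measurable_cst.
  apply: (measurable_oracle oracle); first exact: measurable_vec_cst.
  by apply: (history_coord (G := G) (i := inl (0%N, i))) => //=.
have lift (f : Omega -> 'rV[R]_d) :
    measurable_vec (f : hist (past_and_samples k) -> 'rV[R]_d) ->
    measurable_vec (f : hist (past k.+1) -> 'rV[R]_d).
  move=> mf; exact: (measurable_vec_comp mf (sub_history (G := G) (@samples_sub k))).
have mFt : measurable_vec (fun w : hist (past k.+1) => iter_Ft (state k.+1 w)).
  apply: measurable_vec_if; [exact: measurable_coin|apply: lift..].
    exact: measurable_fresh.
  exact: measurable_corrected.
split=> //.
  case: IH => /lift_past/lift mu _ _.
  have m : measurable_vec (fun w : hist (past k.+1) => 1 / k.+2%:R *: u0 +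
      k.+1%:R / k.+2%:R *: iter_u (state k w)
      - step_size (9 * L ^+ 2) e0 k *: iter_Ft (state k.+1 w)).
    apply: measurable_vecB; [apply: measurable_vecD|]; last by apply: measurable_vecZ.
      exact: measurable_vec_cst.
    exact: measurable_vecZ.
  exact: m.
have mv := lift _ (lift_past (measurable_extrapolated IH)); exact: mv.
Qed.

Let on_Omega J dT (T : measurableType dT) (f : hist J -> T) :
  measurable_fun setT f -> measurable_fun [set: Omega] f.
Proof.
by move=> mf; apply: measurableT_comp mf (measurable_history Gm (J := J)).
Qed.

Lemma measurable_oracle_error k : measurable_fun [set: Omega] (fun w => err k w).
Proof.
have [_ mv mF] := measurable_state k.
have m : measurable_vec (fun w : hist (past k) =>
    iter_Ft (state k w) - F (iter_v (state k w))).
  by apply: measurable_vecB => //; exact: (measurable_oracle_mean oracle).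
exact: on_Omega (measurable_dot dot m m).
Qed.

(** The batch b is independent of J, and the error of its mean is the mean of
    centred samples. *)
Let fresh_batch_sqr J b n (v : hist J -> 'rV[R]_d) :
  (forall i, ~ J (inl (b, i))) -> measurable_vec v -> (0 < n)%N ->
  (\int[P]_w (dot (batch_mean n (fun i => Fhat (v w) (z b i w)) - F (v w))
     (batch_mean n (fun i => Fhat (v w) (z b i w)) - F (v w)))%:E
   <= (sigma ^+ 2 / n%:R)%:E)%E.
Proof.
move=> newJ mv n0.
pose xi w y := Fhat (v w) y - F (v w).
have mv1 : measurable_vec (fun p : hist J * Z => v p.1).
  exact: measurable_vec_comp mv measurable_fst.
have mxi : measurable_vec (fun p : hist J * Z => xi p.1 p.2).
  apply: measurable_vecB; last exact: (measurable_oracle_mean oracle).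
  exact: (measurable_oracle oracle).
have inj : injective (fun i => inl (b, i) : (nat * nat) + nat) by move=> i j [].
have := @batch_mean_sqr R d dot dO Omega P _ G Gm GI GT ind dZ Z Pz J (z b)
  (fun i => inl (b, i)) inj newJ (fun i => erefl) (sample_law rnd b)
  (fun=> 0) (fun=> n) (fun=> sigma ^+ 2) xi
  (measurable_vec_cst (T := hist J) 0) (@measurable_cst _ _ (hist J) _ setT n)
  (@measurable_cst _ _ (hist J) _ setT (sigma ^+ 2)) (fun=> sqr_ge0 sigma) mxi
  (fun w => oracle_noise_mean0 oracle (v w)) (fun w => oracle_noise_sqr oracle (v w)).
under eq_integral do rewrite add0r batch_mean_shift//.
move=> /le_trans; apply.
under eq_integral do rewrite dot0l add0r.
by rewrite integral_cst//= probability_setT mule1.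
Qed.

Lemma oracle_error0_le : (\int[P]_w (err 0 w)%:E <= (eps ^+ 2 / 8)%:E)%E.
Proof.
apply: le_trans (@fresh_batch_sqr set0 0 _ (fun=> u0) _ _ (batch1_gt0 sigma eps 1)) _.
- by move=> i [].
- exact: measurable_vec_cst.
by rewrite lee_fin; have := batch1_variance sigma eps0 ltr01; rewrite mul1r.
Qed.

Lemma fresh_estimate_sqr k :
  (\int[P]_w (dot (fresh_estimate k w - F (extrapolated k w))
                  (fresh_estimate k w - F (extrapolated k w)))%:E
    <= (coin_prob R k * eps ^+ 2 / 8)%:E)%E.
Proof.
apply: le_trans (@fresh_batch_sqr (past k) k.+1 _ (extrapolated k) _ _ (batch1_gt0 _ _ _)) _.
- by move=> i /=; rewrite ltnn.
- exact: (measurable_extrapolated (measurable_state k)).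
- by rewrite lee_fin; apply: batch1_variance => //; exact: coin_prob_gt0.
Qed.

(** The previous error plus the mean of centred differences: the former is known
    before the batch, so the two mean squares add up. *)
Lemma corrected_estimate_sqr k :
  (\int[P]_w (dot (corrected_estimate k w - F (extrapolated k w))
                  (corrected_estimate k w - F (extrapolated k w)))%:E
    <= \int[P]_w (err k w)%:E + (coin_prob R k ^+ 2 * eps ^+ 2 / 8)%:E)%E.
Proof.
have [_ mv' mF] := measurable_state k.
have mv := measurable_extrapolated (measurable_state k).
set p := coin_prob R k; have p0 : 0 < p by exact: coin_prob_gt0.
pose v := extrapolated k; pose v' w := iter_v (state k w).
pose xi w y := Fhat (v w) y - Fhat (v' w) y - (F (v w) - F (v' w)).
pose D w := iter_Ft (state k w) - F (v' w).
pose N w := batch2 dot L eps p (v w) (v' w).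
pose h w := L ^+ 2 * dot (v w - v' w) (v w - v' w).
have mv1 : measurable_vec (fun q : hist (past k) * Z => v q.1).
  exact: measurable_vec_comp mv measurable_fst.
have mv1' : measurable_vec (fun q : hist (past k) * Z => v' q.1).
  exact: measurable_vec_comp mv' measurable_fst.
have mxi : measurable_vec (fun q : hist (past k) * Z => xi q.1 q.2).
  by apply: measurable_vecB; apply: measurable_vecB;
    [exact: (measurable_oracle oracle)..|
     exact: (measurable_oracle_mean oracle)|exact: (measurable_oracle_mean oracle)].
have inj : injective (fun i => inl (k.+1, i) : (nat * nat) + nat) by move=> i j [].
have mD : measurable_vec (D : hist (past k) -> _).
  by apply: measurable_vecB => //; exact: (measurable_oracle_mean oracle).
have mN : measurable_fun [set: hist (past k)] N by exact: measurable_batch2.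
have mh : measurable_fun [set: hist (past k)] h.
  by apply: measurable_funM => //; apply: measurable_dot; exact: measurable_vecB.
have h0 w : 0 <= h w by rewrite mulr_ge0 ?sqr_ge0 ?dot_ge0.
have new i : ~ past k (inl (k.+1, i)) by rewrite /= ltnn.
have := @batch_mean_sqr R d dot dO Omega P _ G Gm GI GT ind dZ Z Pz (past k)
  (z k.+1) (fun i => inl (k.+1, i)) inj new (fun i => erefl)
  (sample_law rnd k.+1) D N h xi mD mN mh h0 mxi
  (fun w => oracle_diff_noise_mean0 oracle (v w) (v' w))
  (fun w => oracle_diff_noise_sqr oracle (v w) (v' w)).
have DE w : D w + batch_mean (N w) (fun i => xi w (z k.+1 i w))
    = corrected_estimate k w - F (extrapolated k w).
  rewrite /corrected_estimate -/p -/v -[batch2 _ _ _ _ _ _]/(N w).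
  have [N0|N0] := posnP (N w).
    rewrite N0 !batch_mean0 !addr0 /D.
    by have /= -> := batch2_eq0 eps0 p0 L0 N0.
  rewrite /xi batch_mean_shift// /D /v.
  by apply/rowP => j; rewrite !mxE; ring.
under eq_integral do rewrite DE.
move=> /le_trans; apply.
have mE := measurable_oracle_error k.
have q0 : 0 <= p ^+ 2 * eps ^+ 2 / 8 by rewrite -exprMn divr_ge0 ?sqr_ge0.
rewrite -[leRHS](_ : \int[P]_w ((err k w)%:E + (p ^+ 2 * eps ^+ 2 / 8)%:E) = _)%E; last first.
  rewrite ge0_integralD//; first last.
  - by apply/measurable_EFinP.
  - by move=> w _; rewrite lee_fin dot_ge0.
  by rewrite integral_cst//= probability_setT mule1.
apply: ge0_le_integral_dominated => w.
  by rewrite lee_fin addr_ge0 ?dot_ge0// divr_ge0.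
rewrite -EFinD lee_fin lerD2l; exact: batch2_variance.
Qed.

(** The coin is independent of the past and of the next batch. *)
Lemma coin_integral k (f g : hist (past_and_samples k) -> R) :
  measurable_fun setT f -> measurable_fun setT g ->
  (forall w, 0 <= f w) -> (forall w, 0 <= g w) ->
  (\int[P]_w (if coin k w then f w else g w)%:E =
   (coin_prob R k)%:E * \int[P]_w (f w)%:E
   + (1 - coin_prob R k)%:E * \int[P]_w (g w)%:E)%E.
Proof.
move=> mf mg f0 g0; set p := coin_prob R k.
have Jk : ~ past_and_samples k (inr k) by rewrite /= ltnn.
pose q (x : hist (past_and_samples k) * bool) := (if x.2 then f x.1 else g x.1)%:E.
have mq : measurable_fun [set: hist (past_and_samples k) * bool] q.
  apply/measurable_EFinP; apply: measurable_fun_ifT.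
  - exact: measurable_snd.
  - exact: measurableT_comp mf measurable_fst.
  - exact: measurableT_comp mg measurable_fst.
have q0 x : (0 <= q x)%E by rewrite lee_fin; case: ifP.
rewrite (history_tonelli Gm GI GT ind Jk erefl mq q0) /q /=.
have pt : distribution P (coin k) [set true] = p%:E := coin_law rnd k.
under eq_integral do rewrite (integral_bool _ _ pt)// EFinD !EFinM.
have p01 : 0 <= p by exact/ltW/coin_prob_gt0.
have p11 : 0 <= 1 - p by rewrite subr_ge0 coin_prob_le1.
have mf' : measurable_fun [set: Omega] (EFin \o f).
  by apply/measurable_EFinP; exact: on_Omega mf.
have mg' : measurable_fun [set: Omega] (EFin \o g).
  by apply/measurable_EFinP; exact: on_Omega mg.
rewrite ge0_integralD//; first last.
- by apply: measurable_funeM.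
- by move=> w _; rewrite mule_ge0 ?lee_fin.
- by apply: measurable_funeM.
- by move=> w _; rewrite mule_ge0 ?lee_fin.
by rewrite !ge0_integralZl ?lee_fin// => w _; rewrite lee_fin.
Qed.

Lemma oracle_error_recursion k :
  (\int[P]_w (err k.+1 w)%:E <=
   (coin_prob R k ^+ 2 * eps ^+ 2 / 8)%:E
   + (1 - coin_prob R k)%:E * (\int[P]_w (err k w)%:E
       + (coin_prob R k ^+ 2 * eps ^+ 2 / 8)%:E))%E.
Proof.
have mS := measurable_state k.
have mFv := measurable_oracle_mean oracle (lift_past (measurable_extrapolated mS)).
have m1 := measurable_vecB (measurable_fresh mS) mFv.
have m2 := measurable_vecB (measurable_corrected mS) mFv.
have mm1 := measurable_dot dot m1 m1; have mm2 := measurable_dot dot m2 m2.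
rewrite [leLHS](_ : _ = \int[P]_w (if coin k w then
    dot (fresh_estimate k w - F (extrapolated k w))
        (fresh_estimate k w - F (extrapolated k w))
  else dot (corrected_estimate k w - F (extrapolated k w))
        (corrected_estimate k w - F (extrapolated k w)))%:E)%E; last first.
  by apply: eq_integral => w _; rewrite /oracle_error iter_FtS; case: (coin k w).
have -> := coin_integral mm1 mm2 (fun=> dot_ge0 _ _) (fun=> dot_ge0 _ _).
apply: leeD.
  have := fresh_estimate_sqr k.
  rewrite (_ : coin_prob R k ^+ 2 * eps ^+ 2 / 8 =
    coin_prob R k * (coin_prob R k * eps ^+ 2 / 8)); last by ring.
  rewrite [leRHS]EFinM; apply: lee_wpmul2l.
  by rewrite lee_fin; exact/ltW/coin_prob_gt0.
apply: lee_wpmul2l; last exact: corrected_estimate_sqr.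
by rewrite lee_fin subr_ge0 coin_prob_le1.
Qed.

(** The recursion propagates eps^2/k: with p = 2/(k+1) the factor 1 - p gains more
    than what the two terms of order p^2 lose. *)
Lemma oracle_errorS_le k : (\int[P]_w (err k.+1 w)%:E <= (eps ^+ 2 / k.+1%:R)%:E)%E.
Proof.
have e2 : 0 < eps ^+ 2 by rewrite exprn_gt0.
elim: k => [|k IH]; apply: le_trans (oracle_error_recursion _) _.
  have -> : coin_prob R 0 = 1.
    by rewrite /coin_prob divr1; apply/min_idPr; lra.
  by rewrite subrr mul0e adde0 expr1n mul1r divr1 lee_fin; lra.
set p := coin_prob R k.+1.
apply: (@le_trans _ _ ((p ^+ 2 * eps ^+ 2 / 8)%:E + (1 - p)%:E *
   ((eps ^+ 2 / k.+1%:R)%:E + (p ^+ 2 * eps ^+ 2 / 8)%:E))%E).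
  apply: leeD => //; apply: lee_wpmul2l.
    by rewrite lee_fin subr_ge0 coin_prob_le1.
  exact: leeD.
rewrite -EFinD lee_fin.
have k1 : 1 <= k.+1%:R :> R by rewrite ler1n.
have k2 : k.+2%:R = k.+1%:R + 1 :> R by rewrite -addn1 natrD.
have -> : p = 2 / k.+2%:R.
  by apply/min_idPl; rewrite ler_pdivrMr// mul1r ler_nat.
rewrite k2; move: (k.+1%:R) k1 => n n1.
rewrite -subr_ge0.
set lhs := (X in 0 <= X).
have -> : lhs = eps ^+ 2 * (1 + 2 * n) / (n * (n + 1) ^+ 3).
  by rewrite /lhs; field; lra.
apply: divr_ge0; first by apply: mulr_ge0; [exact: ltW|lra].
by apply: mulr_ge0; [lra|apply: exprn_ge0; lra].
Qed.

End EstimatorError.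

(** * Bounds in mean *)

Section MeanBound.
Context (R : realType) (dO : measure_display) (Omega : measurableType dO)
  (P : probability Omega R).
Implicit Types (X Y : Omega -> R) (a b c : R).

(** A bound on an upper integral, stable under sums, scaling and pointwise
    domination: inequalities along a run turn at once into bounds in mean. *)
Definition mean_le X c := exists Y, [/\ measurable_fun setT Y,
  forall w, 0 <= Y w, forall w, X w <= Y w & (\int[P]_w (Y w)%:E <= c%:E)%E].

Lemma mean_le_expectation X c : (forall w, 0 <= X w) -> mean_le X c ->
  ('E_P[X] <= c%:E)%E.
Proof.
move=> X0 [Y [mY Y0 XY Yc]]; rewrite unlock; apply: le_trans Yc.
by apply: ge0_le_integral_dominated => w; rewrite lee_fin.
Qed.

Lemma mean_le_measurable X c : measurable_fun setT X -> (forall w, 0 <= X w) ->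
  (\int[P]_w (X w)%:E <= c%:E)%E -> mean_le X c.
Proof. by move=> mX X0 Xc; exists X. Qed.

Lemma mean_le_trans X X' c c' : (forall w, X w <= X' w) -> c' <= c ->
  mean_le X' c' -> mean_le X c.
Proof.
move=> XX' cc' [Y [mY Y0 X'Y Yc]]; exists Y; split=> // [w|].
  exact: le_trans (XX' w) (X'Y w).
by apply: le_trans Yc _; rewrite lee_fin.
Qed.

Lemma mean_le_cst c : 0 <= c -> mean_le (fun=> c) c.
Proof.
move=> c0; apply: mean_le_measurable => //.
by rewrite integral_cst//= probability_setT mule1.
Qed.

Lemma mean_leD X X' c c' : mean_le X c -> mean_le X' c' ->
  mean_le (fun w => X w + X' w) (c + c').
Proof.
move=> [Y [mY Y0 XY Yc]] [Y' [mY' Y'0 X'Y' Y'c]].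
exists (fun w => Y w + Y' w); split.
- exact: measurable_funD.
- by move=> w; rewrite addr_ge0.
- by move=> w; rewrite lerD.
under eq_integral do rewrite EFinD.
rewrite ge0_integralD//; first by rewrite EFinD leeD.
- by move=> w _; rewrite lee_fin.
- exact/measurable_EFinP.
- by move=> w _; rewrite lee_fin.
- exact/measurable_EFinP.
Qed.

Lemma mean_leZ a X c : 0 <= a -> mean_le X c -> mean_le (fun w => a * X w) (a * c).
Proof.
move=> a0 [Y [mY Y0 XY Yc]]; exists (fun w => a * Y w); split.
- exact: measurable_funM.
- by move=> w; rewrite mulr_ge0.
- by move=> w; rewrite ler_wpM2l.
under eq_integral do rewrite EFinM.
rewrite ge0_integralZl//; first by rewrite EFinM; apply: lee_wpmul2l; rewrite ?lee_fin.
- exact/measurable_EFinP.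
- by move=> w _; rewrite lee_fin.
Qed.

Lemma mean_le_sum n (X : 'I_n -> Omega -> R) (c : 'I_n -> R) :
  (forall i, mean_le (X i) (c i)) ->
  mean_le (fun w => \sum_(i < n) X i w) (\sum_(i < n) c i).
Proof.
elim: n X c => [|n IH] X c Xc.
  by rewrite big_ord0; apply: mean_le_trans (mean_le_cst (lexx 0)) => // w; rewrite big_ord0.
rewrite big_ord_recl.
apply: mean_le_trans (mean_leD (Xc ord0) (IH _ _ (fun i => Xc (lift ord0 i)))) => // w.
by rewrite big_ord_recl.
Qed.

End MeanBound.

Section MeanBounds.
Context (R : realType) (d : nat) (dot : {dot 'rV[R]_d for idfun})
  (F : 'rV[R]_d -> 'rV[R]_d) (sigma L e0 eps : R) (u0 us : 'rV[R]_d)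
  (dZ : measure_display) (Z : measurableType dZ) (Pz : probability Z R)
  (Fhat : 'rV[R]_d -> Z -> 'rV[R]_d)
  (dO : measure_display) (Omega : measurableType dO) (P : probability Omega R)
  (z : nat -> nat -> {RV P >-> Z}) (coin : nat -> {RV P >-> bool}).
Hypotheses (L0 : 0 < L) (eps0 : 0 < eps)
  (Fmono : monotone_operator dot F) (Flip : lipschitz_operator dot L F)
  (oracle : stochastic_oracle dot F Pz Fhat sigma L) (Fus : F us = 0)
  (e00 : 0 < e0) (Me : 9 * L ^+ 2 * e0 ^+ 2 <= 1 / 3)
  (rnd : algorithm_randomness Pz z coin).

Local Notation state k w := (halpern dot Fhat sigma L e0 eps u0
  (fun b i => z b i w) (fun j => coin j w) k).
Local Notation err k w := (oracle_error dot F L e0 u0 Fhat sigma eps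
  (fun b i => z b i w) (fun j => coin j w) k).
Local Notation res k w := (sqr_residual dot F L e0 u0 Fhat sigma eps
  (fun b i => z b i w) (fun j => coin j w) k).
Local Notation away k w :=
  (dot (iter_u (state k w) - u0) (iter_u (state k w) - u0)).
Local Notation M := (9 * L ^+ 2).
Local Notation eta_ := (eta_lim L e0).
Local Notation dist2 := (dot (u0 - us) (u0 - us)).
Local Notation Lambda0 := (4 * (L ^+ 2 * e0 * eta_ + 1) * dist2 / eta_ ^+ 2).
Local Notation Lambda1 := (5 * (1 + M * eta_ * e0) / (M * eta_ ^+ 2)).

Lemma mean_oracle_errorS k : mean_le P (fun w => err k.+1 w) (eps ^+ 2 / k.+1%:R).
Proof.
apply: mean_le_measurable; first exact: (measurable_oracle_error _ _ _ z coin oracle).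
  by move=> w; exact: oracle_error_ge0.
exact: (oracle_errorS_le _ _ L0 eps0 oracle rnd).
Qed.

Lemma mean_oracle_error k : mean_le P (fun w => err k w) (2 * eps ^+ 2 / k.+1%:R).
Proof.
have e2 : 0 < eps ^+ 2 by rewrite exprn_gt0.
case: k => [|k].
  apply: (@mean_le_trans _ _ _ _ _ (fun w => err 0 w) _ (eps ^+ 2 / 8)) => //.
    by rewrite divr1; lra.
  apply: mean_le_measurable; first exact: (measurable_oracle_error _ _ _ z coin oracle).
    by move=> w; exact: oracle_error_ge0.
  exact: (oracle_error0_le _ _ eps0 oracle rnd).
apply: mean_le_trans (mean_oracle_errorS k) => //.
have k1 : 1 <= k.+1%:R :> R by rewrite ler1n.
have -> : k.+2%:R = k.+1%:R + 1 :> R by rewrite -addn1 natrD.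
move: (k.+1%:R) k1 => n n1.
rewrite ler_pdivlMr; last by lra.
rewrite mulrAC ler_pdivrMr; last by lra.
by have := mulr_ge0 (ltW e2) (_ : 0 <= n - 1); rewrite subr_ge0 => /(_ n1); lra.
Qed.

Lemma sum_succ2_le k : \sum_(i < k) i.+2%:R <= k.+1%:R * k.+2%:R / 2 :> R.
Proof.
elim: k => [|k IH]; first by rewrite big_ord0 !mulr_ge0.
rewrite big_ord_recr /=; apply: le_trans (lerD IH (lexx _)) _.
have -> : k.+3%:R = k.+1%:R + 2 :> R by rewrite -addn2 natrD.
have -> : k.+2%:R = k.+1%:R + 1 :> R by rewrite -addn1 natrD.
lra.
Qed.

(** With errors of mean eps^2/k the noise of step i is at most (i+2) c, and the
    sum over i < k is at most (k+1)(k+2)/2 times c. *)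
Lemma mean_residual k : mean_le P (fun w => res k w)
  (Lambda0 / (k.+1%:R * k.+2%:R) + Lambda1 * eps ^+ 2).
Proof.
have M0 : 0 < M by rewrite mulr_gt0 ?exprn_gt0.
have el0 := eta_lim_gt0 L0 e00 Me.
pose c := eps ^+ 2 * (1 / (M * eta_) + 2 * e0).
have noise i : mean_le P (fun w => step_noise dot F L e0 u0 Fhat sigma eps
    (fun b i => z b i w) (fun j => coin j w) i) (i.+2%:R * c).
  have i0 : 0 < i.+1%:R :> R by [].
  have iMe : 0 <= (M * eta_)^-1 by rewrite invr_ge0 ltW// mulr_gt0.
  have := mean_leZ (_ : 0 <= i.+1%:R * i.+2%:R) (mean_leD (mean_leZ iMe (mean_oracle_errorS i))
     (mean_leZ (ltW e00) (mean_oracle_error i))).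
  move=> /(_ (mulr_ge0 (ler0n _ _) (ler0n _ _))); apply: mean_le_trans => [w|].
    by rewrite /step_noise (mulrC (M * eta_)^-1).
  rewrite /c le_eqVlt; apply/orP; left; apply/eqP.
  by move: (eta_) el0 => el el0; field; rewrite !gt_eqF//; lra.
have K0 : 0 < k.+1%:R * k.+2%:R :> R by rewrite mulr_gt0.
have c0 : 0 <= 4 / (eta_ * (k.+1%:R * k.+2%:R)).
  by rewrite divr_ge0// ltW// mulr_gt0.
have L00 : 0 <= Lambda0 / (k.+1%:R * k.+2%:R).
  rewrite divr_ge0 ?(ltW K0)// divr_ge0 ?sqr_ge0// mulr_ge0 ?dot_ge0//.
  by rewrite mulr_ge0// addr_ge0// mulr_ge0 ?(ltW el0)// mulr_ge0 ?sqr_ge0 ?(ltW e00).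
have := mean_leD (mean_le_cst P L00) (mean_leZ c0 (mean_le_sum (fun i : 'I_k => noise i))).
apply: mean_le_trans => [w|]; first exact: sqr_residual_le.
rewrite lerD2l -mulr_suml.
have cc0 : 0 <= c.
  apply: mulr_ge0; first exact: sqr_ge0.
  apply: addr_ge0; first by rewrite mul1r invr_ge0 ltW// mulr_gt0.
  by rewrite mulr_ge0 ?(ltW e00).
apply: (@le_trans _ _ (4 / (eta_ * (k.+1%:R * k.+2%:R)) * (k.+1%:R * k.+2%:R / 2 * c))).
  by rewrite ler_wpM2l// ler_wpM2r// sum_succ2_le.
move: (k.+1%:R * k.+2%:R) K0 => K K0.
rewrite /c -subr_ge0; move: (eta_) el0 => el el0.
rewrite (_ : _ - _ = eps ^+ 2 * (3 + M * el * e0) / (M * el ^+ 2)); last first.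
  by field; rewrite !gt_eqF.
apply: divr_ge0; last by rewrite ltW// mulr_gt0 ?exprn_gt0.
apply: mulr_ge0; first exact: sqr_ge0.
by apply: addr_ge0 => //; rewrite ltW// !mulr_gt0.
Qed.

Section Queries.
(* Up to k = N, the terms Lambda_1 eps^2 and eps^2/k of the mean bounds are
   dominated by g / (k+1)^2, the same order as the deterministic decay. *)
Variables (N : nat) (g : R).
Hypothesis gE : 3 * Lambda0 + 3 * Lambda1 * eps ^+ 2 * N.+1%:R ^+ 2
  + 6 * eps ^+ 2 * N.+1%:R ^+ 2 <= g.

Lemma Lambda1_ge0 : 0 <= Lambda1.
Proof.
have M0 : 0 < M by rewrite mulr_gt0 ?exprn_gt0.
have el0 := eta_lim_gt0 L0 e00 Me; move: (eta_) el0 => el el0.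
apply: divr_ge0; last by rewrite ltW// mulr_gt0 ?exprn_gt0.
by apply: mulr_ge0 => //; apply: addr_ge0 => //; rewrite ltW// !mulr_gt0.
Qed.

Lemma Lambda0_ge0 : 0 <= Lambda0.
Proof.
have el0 := eta_lim_gt0 L0 e00 Me; move: (eta_) el0 => el el0.
apply: divr_ge0; last by rewrite sqr_ge0.
apply: mulr_ge0; last exact: dot_ge0.
apply: mulr_ge0 => //; apply: addr_ge0 => //.
by rewrite ltW// !mulr_gt0 ?exprn_gt0.
Qed.

Let g0 : 0 <= g.
Proof.
apply: le_trans gE; have l1 := Lambda1_ge0; have l0 := Lambda0_ge0.
have e2 := sqr_ge0 eps; have n2 := sqr_ge0 (N.+1%:R : R).
have := mulr_ge0 (mulr_ge0 l1 e2) n2; have := mulr_ge0 e2 n2.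
move: (Lambda0) (Lambda1) (eps ^+ 2) (N.+1%:R ^+ 2) l0 => a b c m; lra.
Qed.

Local Notation Ft_bound k w := (3 * res k w + 3 * err k w).

Lemma mean_Ft k : (k <= N)%N ->
  mean_le P (fun w => Ft_bound k w) (g / k.+1%:R ^+ 2).
Proof.
move=> kN.
have := mean_leD (mean_leZ (ler0n _ 3) (mean_residual k)) (mean_leZ (ler0n _ 3) (mean_oracle_error k)).
apply: mean_le_trans => //.
have l1 := Lambda1_ge0; have l0 := Lambda0_ge0; have e2 := sqr_ge0 eps.
have k1 : 1 <= k.+1%:R :> R by rewrite ler1n.
have kN' : k.+1%:R <= N.+1%:R :> R by rewrite ler_nat.
have k2 : k.+2%:R = k.+1%:R + 1 :> R by rewrite -addn1 natrD.
rewrite k2 {k2}; move: (k.+1%:R) (N.+1%:R) k1 kN' gE => n m n1 nm gE'.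
have n0 : 0 < n by lra.
rewrite ler_pdivlMr ?exprn_gt0//; apply: le_trans gE'.
have nm2 : n ^+ 2 <= m ^+ 2 by rewrite lerXn2r ?nnegrE//; lra.
have f0 : Lambda0 / (n * (n + 1)) * n ^+ 2 <= Lambda0.
  rewrite mulrAC ler_pdivrMr; last by rewrite mulr_gt0//; lra.
  by rewrite ler_wpM2l// expr2 ler_pM2l//; lra.
have f1 : Lambda1 * eps ^+ 2 * n ^+ 2 <= Lambda1 * eps ^+ 2 * m ^+ 2.
  by rewrite ler_wpM2l// mulr_ge0.
have f2 : 2 * eps ^+ 2 / n * n ^+ 2 <= 2 * eps ^+ 2 * m ^+ 2.
  rewrite -mulrA; apply: ler_wpM2l; first by rewrite mulr_ge0.
  rewrite [X in _ * X]expr2 mulKf ?gt_eqF//.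
  by apply: le_trans nm2; rewrite expr2 ler_peMl//; lra.
move: f0 f1 f2; move: (Lambda0) (Lambda1) (eps ^+ 2) (_ / (_ * _)) (_ / n) => a b c q r.
lra.
Qed.

(** By convexity, the mean square distance to u_0 never exceeds the largest mean
    square of the increments (k+2) e0 Ftilde. *)
Lemma mean_away k : (k <= N)%N -> mean_le P (fun w => away k w) (e0 ^+ 2 * g).
Proof.
have A0 : 0 <= e0 ^+ 2 * g by rewrite mulr_ge0 ?sqr_ge0.
elim: k => [_|k IH kN].
  apply: mean_le_trans (mean_le_cst P A0) => // w.
  by rewrite /= subrr dot0l.
have k2 : k.+2%:R = k.+1%:R + 1 :> R by rewrite -addn1 natrD.
have c1 : 0 <= k.+1%:R / k.+2%:R :> R by rewrite divr_ge0.
have c2 : 0 <= k.+2%:R * e0 ^+ 2 by rewrite mulr_ge0 ?sqr_ge0.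
have := mean_leD (mean_leZ c1 (IH (ltnW kN))) (mean_leZ c2 (mean_Ft kN)).
apply: mean_le_trans => [w|]; first exact: away_anchorS.
rewrite k2 le_eqVlt; apply/orP; left; apply/eqP.
have : 0 < k.+1%:R :> R by []; move: (k.+1%:R) => n n0; field; lra.
Qed.

(** The move v_k - v_{k-1} consists of an anchoring part, of size away / (k+2)^2, a
    step along the estimate, and u_k - v_{k-1}. *)
Lemma mean_extrapolation k : (k <= N)%N -> mean_le P
  (fun w => dot (iter_v (state k.+1 w) - iter_v (state k w))
                (iter_v (state k.+1 w) - iter_v (state k w)))
  (3 * (2 * e0 ^+ 2 + 1 / (2 * L ^+ 2)) * g / k.+1%:R ^+ 2).
Proof.
move=> kN; have L2 : 0 < 2 * L ^+ 2 by rewrite mulr_gt0 ?exprn_gt0.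
have k1 : 0 < k.+1%:R :> R by [].
have c1 : 0 <= (k.+2%:R ^+ 2)^-1 :> R by rewrite invr_ge0 sqr_ge0.
have c2 : 0 <= (2 * L ^+ 2)^-1 by rewrite invr_ge0 ltW.
have r : mean_le P (fun w => res k w) (g / k.+1%:R ^+ 2).
  apply: mean_le_trans (mean_Ft kN) => // w.
  have := oracle_error_ge0 dot F L e0 u0 Fhat sigma eps (fun b i => z b i w) (fun j => coin j w) k.
  have : 0 <= res k w; last by lra.
  by rewrite addr_ge0 ?dot_ge0// mulr_ge0 ?dot_ge0// ltW.
have := mean_leZ (ler0n _ 3) (mean_leD (mean_leD (mean_leZ c1 (mean_away kN))
   (mean_leZ (sqr_ge0 e0) (mean_Ft kN))) (mean_leZ c2 r)).
apply: mean_le_trans => [w|].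
  apply: le_trans (sqr_extrapolation_le u0 Fhat sigma eps _ _ L0 Flip e00 Me k) _.
  by rewrite ler_pM2l// (mulrC (k.+2%:R ^+ 2)^-1) (mulrC (2 * L ^+ 2)^-1).
have kk : (k.+2%:R ^+ 2)^-1 <= (k.+1%:R ^+ 2)^-1 :> R.
  by rewrite lef_pV2 ?posrE ?exprn_gt0// lerXn2r ?nnegrE// ler_nat.
have := ler_wpM2r (mulr_ge0 (sqr_ge0 e0) g0) kk.
move: ((2 * L ^+ 2)^-1) ((k.+2%:R ^+ 2)^-1) ((k.+1%:R ^+ 2)^-1) => a b c.
lra.
Qed.

(** A fresh batch is long, of order 1/p, but is drawn only with probability p. *)
Lemma mean_fresh_cost j : mean_le P
  (fun w => if coin j w then (batch1 sigma eps (coin_prob R j))%:R else 0)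
  (8 * sigma ^+ 2 / eps ^+ 2 + 1).
Proof.
set b := (batch1 sigma eps (coin_prob R j))%:R : R.
have p0 := coin_prob_gt0 R j; have p1 := coin_prob_le1 R j.
have b0 : 0 <= b by [].
have mb : measurable_fun [set: Omega] (fun w => if coin j w then b else 0).
  apply: measurable_fun_ifT; [exact: measurable_funP|exact: measurable_cst|exact: measurable_cst].
apply: mean_le_measurable => // [w|]; first by case: ifP.
rewrite (coin_integral rnd (f := fun=> b) (g := fun=> 0))//.
rewrite integral0 mule0 adde0 integral_cst//= probability_setT mule1 -EFinM lee_fin.
apply: (@le_trans _ _ (coin_prob R j * (8 * sigma ^+ 2 / (coin_prob R j * eps ^+ 2) + 1))).
  by rewrite ler_pM2l//; exact: batch1_le.
rewrite mulrDr mulr1 lerD// le_eqVlt; apply/orP; left; apply/eqP.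
by field; rewrite !gt_eqF.
Qed.

(** The size of a correction batch carries a factor 1/p^2 <= (j+1)^2, which the
    mean square of the move cancels. *)
Lemma mean_queries : mean_le P
  (fun w => (halpern_queries dot Fhat sigma L e0 eps u0
     (fun b i => z b i w) (fun j => coin j w) N)%:R)
  (N.+1%:R * (8 * sigma ^+ 2 / eps ^+ 2 + 3
     + 48 * (2 * (L * e0) ^+ 2 + 1 / 2) * g / eps ^+ 2)).
Proof.
set s := 8 * sigma ^+ 2 / eps ^+ 2.
set h := 48 * _ * g / eps ^+ 2.
have s0 : 0 <= s by rewrite /s divr_ge0 ?sqr_ge0// pmulr_rge0 ?sqr_ge0.
have h0 : 0 <= h.
  rewrite /h divr_ge0 ?sqr_ge0// mulr_ge0// mulr_ge0// addr_ge0//.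
  by rewrite pmulr_rge0 ?sqr_ge0.
pose dv j w := dot (iter_v (state j.+1 w) - iter_v (state j w))
                (iter_v (state j.+1 w) - iter_v (state j w)).
pose c j : R := 16 * L ^+ 2 / (coin_prob R j ^+ 2 * eps ^+ 2).
have pe j : 0 < coin_prob R j ^+ 2 * eps ^+ 2.
  by rewrite mulr_gt0 ?exprn_gt0 ?coin_prob_gt0.
have c0 j : 0 <= c j.
  by rewrite /c divr_ge0 ?(ltW (pe j))// mulr_ge0 ?sqr_ge0.
have step (j : 'I_N) : mean_le P (fun w =>
    (if coin j w then (batch1 sigma eps (coin_prob R j))%:R else 0)
    + (c j * dv j w + 2)) (s + 1 + (h + 2)).
  apply: mean_leD; first exact: mean_fresh_cost.
  apply: mean_leD; last exact: mean_le_cst.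
  have jN := ltnW (ltn_ord j).
  apply: mean_le_trans (mean_leZ (c0 j) (mean_extrapolation jN)) => //.
  have := coin_prob_ge R j; set p := coin_prob R j => pj.
  have p0 : 0 < p by exact: coin_prob_gt0.
  have j0 : 0 < j.+1%:R :> R by [].
  rewrite /c /h -/p; move: (j.+1%:R) j0 pj => n n0 pn.
  have np : 1 <= (p * n) ^+ 2.
    by rewrite exprn_ege1// -ler_pdivrMr// div1r.
  have -> : 16 * L ^+ 2 / (p ^+ 2 * eps ^+ 2) *
     (3 * (2 * e0 ^+ 2 + 1 / (2 * L ^+ 2)) * g / n ^+ 2)
     = 48 * (2 * (L * e0) ^+ 2 + 1 / 2) * g / eps ^+ 2 / (p * n) ^+ 2.
    by field; rewrite !gt_eqF.
  have pn0 : 0 < (p * n) ^+ 2 by rewrite exprn_gt0// mulr_gt0.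
  by rewrite -/h ler_pdivrMr//; apply: ler_peMr.
have first_batch : (batch1 sigma eps 1)%:R <= s + 1 :> R.
  by have := batch1_le sigma eps0 ltr01; rewrite mul1r.
have := mean_leD (mean_le_cst P (ler0n _ (batch1 sigma eps 1))) (mean_le_sum step).
apply: mean_le_trans => [w|].
  rewrite /halpern_queries natrD lerD2l natr_sum ler_sum// => j _.
  case: (coin j w).
    rewrite lerDl addr_ge0// mulr_ge0 ?dot_ge0//.
  rewrite add0r natrM.
  have := batch2_le dot L eps (coin_prob R j) (iter_v (state j.+1 w)) (iter_v (state j w)).
  rewrite -/(dv j w) => H; have := ler_wpM2l (ler0n R 2) H.
  rewrite /c; move: ((_ * eps ^+ 2)^-1) (dv j w) (batch2 _ _ _ _ _ _)%:R => q r b.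
  lra.
rewrite sumr_const card_ord -(mulr_natl (s + 1 + (h + 2)) N).
have N0 : 0 <= N%:R :> R by [].
rewrite -[N.+1%:R]natr1; move: (N%:R) N0 => n n0.
have := mulr_ge0 n0 s0; have := mulr_ge0 n0 h0; lra.
Qed.

End Queries.

End MeanBounds.

(** * Constants and conclusion *)

Section ScaleFreeConstants.
Context (R : realType).
Implicit Types (y L : R).

(** L times eta_lim as a function of y = L e0; likewise the next two definitions
    are Lambda_0 / (L dist)^2 and Lambda_1. *)
Definition scaled_eta y : R := y * (1 - 18 * y ^+ 2) / (1 - 9 * y ^+ 2).

Definition scaled_Lambda0 y : R :=
  4 * (y * scaled_eta y + 1) / scaled_eta y ^+ 2.

Definition scaled_Lambda1 y : R :=
  5 * (1 + 9 * scaled_eta y * y) / (9 * scaled_eta y ^+ 2).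

(** Adding 2 pays for the ceiling in N and for passing from N to N + 1, once
    eps <= L dist. *)
Definition iteration_const y : R :=
  Num.sqrt (scaled_Lambda0 y) / Num.sqrt (scaled_Lambda1 y) + 2.

(** The constant g of the bound g / (k+1)^2 on the mean square of the estimates,
    divided by (L dist)^2. *)
Definition Ft_const y : R :=
  3 * scaled_Lambda0 y + (3 * scaled_Lambda1 y + 6) * iteration_const y ^+ 2.

Definition query_const y : R :=
  iteration_const y * (11 + 48 * (2 * y ^+ 2 + 1 / 2) * Ft_const y).

Definition hidden_const y : R :=
  2 * scaled_Lambda1 y + iteration_const y + query_const y.

Lemma scaled_etaE L e0 : 0 < L -> 9 * L ^+ 2 * e0 ^+ 2 <= 1 / 3 ->
  eta_lim L e0 = scaled_eta (L * e0) / L.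
Proof.
move=> L0 Me; rewrite /eta_lim /scaled_eta; field.
by rewrite !gt_eqF//; lra.
Qed.

Context (L e0 : R).
Hypotheses (L0 : 0 < L) (e00 : 0 < e0) (Me : 9 * L ^+ 2 * e0 ^+ 2 <= 1 / 3).
Local Notation y := (L * e0).
Local Notation eta_ := (eta_lim L e0).

Lemma scaled_eta_gt0 : 0 < scaled_eta y.
Proof.
have := eta_lim_gt0 L0 e00 Me; rewrite scaled_etaE//.
by rewrite pmulr_lgt0 ?invr_gt0.
Qed.

Lemma Lambda1E :
  5 * (1 + 9 * L ^+ 2 * eta_ * e0) / (9 * L ^+ 2 * eta_ ^+ 2) = scaled_Lambda1 y.
Proof.
rewrite scaled_etaE// /scaled_Lambda1; have := scaled_eta_gt0.
by move: (scaled_eta _) => h h0; field; rewrite !gt_eqF.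
Qed.

Lemma Lambda0E D :
  4 * (L ^+ 2 * e0 * eta_ + 1) * D ^+ 2 / eta_ ^+ 2
  = scaled_Lambda0 y * (L * D) ^+ 2.
Proof.
rewrite scaled_etaE// /scaled_Lambda0; have := scaled_eta_gt0.
by move: (scaled_eta _) => h h0; field; rewrite !gt_eqF.
Qed.

Lemma scaled_Lambda0_gt0 : 0 < scaled_Lambda0 y.
Proof.
have h0 := scaled_eta_gt0; have y0 : 0 < y by rewrite mulr_gt0.
apply: divr_gt0; last by rewrite exprn_gt0.
by apply: mulr_gt0 => //; apply: addr_gt0 => //; exact: mulr_gt0.
Qed.

Lemma scaled_Lambda1_gt0 : 0 < scaled_Lambda1 y.
Proof.
have h0 := scaled_eta_gt0; have y0 : 0 < y by rewrite mulr_gt0.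
apply: divr_gt0; last by apply: mulr_gt0 => //; rewrite exprn_gt0.
apply: mulr_gt0 => //; apply: addr_gt0 => //.
by apply: mulr_gt0 => //; exact: mulr_gt0.
Qed.

Lemma iteration_const_ge2 : 2 <= iteration_const y.
Proof. by rewrite /iteration_const lerDr divr_ge0 ?sqrtr_ge0. Qed.

Lemma Ft_const_ge0 : 0 <= Ft_const y.
Proof.
have l0 := scaled_Lambda0_gt0; have l1 := scaled_Lambda1_gt0.
apply: addr_ge0; first by lra.
by apply: mulr_ge0; [lra|exact: sqr_ge0].
Qed.

Lemma query_const_ge0 : 0 <= query_const y.
Proof.
have c0 := Ft_const_ge0; have b2 := iteration_const_ge2.
apply: mulr_ge0; first lra.
apply: addr_ge0 => //; apply: mulr_ge0 => //; apply: mulr_ge0 => //.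
by apply: addr_ge0 => //; rewrite pmulr_rge0 ?sqr_ge0.
Qed.

(** N >= sqrt a / (sqrt b eps) already gives a <= N^2 b eps^2. *)
Lemma iterations_suffice (a b eps : R) (N : nat) : 0 <= a -> 0 < b -> 0 < eps ->
  N = ceiln (Num.sqrt a / (Num.sqrt b * eps)) ->
  a / (N.+1%:R * N.+2%:R) <= b * eps ^+ 2.
Proof.
move=> a0 b0 ep NE.
have sb : 0 < Num.sqrt b by rewrite sqrtr_gt0.
have se : 0 < Num.sqrt b * eps by rewrite mulr_gt0.
have := ceiln_ge (divr_ge0 (sqrtr_ge0 a) (ltW se)); rewrite -NE ler_pdivrMr// => H.
have {H} : a <= N%:R ^+ 2 * (b * eps ^+ 2).
  have := H; rewrite -(@ler_pXn2r _ 2) ?nnegrE ?sqrtr_ge0//; last first.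
    by rewrite mulr_ge0// ltW.
  by rewrite !exprMn !sqr_sqrtr// ltW.
move=> /le_trans H; rewrite ler_pdivrMr ?mulr_gt0//; apply: H.
rewrite mulrC ler_pM2l ?mulr_gt0 ?exprn_gt0// expr2.
by rewrite -!natrM ler_nat leq_mul// ltnW.
Qed.

Lemma iterations_le (D eps : R) : 0 < eps -> eps <= L * D ->
  (ceiln (Num.sqrt (scaled_Lambda0 y * (L * D) ^+ 2)
     / (Num.sqrt (scaled_Lambda1 y) * eps))).+1%:R
  <= iteration_const y * (L * D / eps).
Proof.
move=> ep eD.
have LD : 0 <= L * D by apply: le_trans eD; exact: ltW.
have X1 : 1 <= L * D / eps by rewrite ler_pdivlMr// mul1r.
have sb : 0 < Num.sqrt (scaled_Lambda1 y) by rewrite sqrtr_gt0 scaled_Lambda1_gt0.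
have -> : Num.sqrt (scaled_Lambda0 y * (L * D) ^+ 2) / (Num.sqrt (scaled_Lambda1 y) * eps)
   = Num.sqrt (scaled_Lambda0 y) / Num.sqrt (scaled_Lambda1 y) * (L * D / eps).
  rewrite sqrtrM ?(ltW scaled_Lambda0_gt0)// sqrtr_sqr ger0_norm//.
  by move: (Num.sqrt _) (Num.sqrt _) sb => p q q0; field; rewrite !gt_eqF.
rewrite -natr1 /iteration_const.
have r0 : 0 <= Num.sqrt (scaled_Lambda0 y) / Num.sqrt (scaled_Lambda1 y).
  by rewrite divr_ge0 ?sqrtr_ge0.
move: (_ / Num.sqrt _) r0 (L * D / eps) X1 => r r0 X X1.
have rX : 0 <= r * X by rewrite mulr_ge0//; lra.
have := ceiln_le rX; lra.
Qed.

End ScaleFreeConstants.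

(* C carries the constants hidden in the O(.) bounds: a function of L * eta0
   alone, chosen before all the data of the problem. *)
Theorem theorem4p1 (R : realType) :
  exists C : R -> R,
  forall (d : nat) (dot : {dot 'rV[R]_d for idfun})
    (F : 'rV[R]_d -> 'rV[R]_d) (sigma L eta0 : R) (u0 ustar : 'rV[R]_d)
    (dZ : measure_display) (Z : measurableType dZ) (Pz : probability Z R)
    (Fhat : 'rV[R]_d -> Z -> 'rV[R]_d)
    (dO : measure_display) (Omega : measurableType dO)
    (P : probability Omega R)
    (z : nat -> nat -> {RV P >-> Z}) (coin : nat -> {RV P >-> bool}),
  0 <= sigma -> 0 < L ->
  monotone_operator dot F ->
  lipschitz_operator dot L F ->
  stochastic_oracle dot F Pz Fhat sigma L ->
  F ustar = 0 ->
  0 < eta0 -> eta0 <= 1 / (3 * Num.sqrt 3 * L) ->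
  algorithm_randomness Pz z coin ->
  let M := 9 * L ^+ 2 in
  let eta_ := eta0 * (1 - 2 * M * eta0 ^+ 2) / (1 - M * eta0 ^+ 2) in
  let dist := dot_norm dot (u0 - ustar) in
  let Lambda0 := 4 * (L ^+ 2 * eta0 * eta_ + 1) * dist ^+ 2 / eta_ ^+ 2 in
  let Lambda1 := 5 * (1 + M * eta_ * eta0) / (M * eta_ ^+ 2) in
  let state eps k w := halpern dot Fhat sigma L eta0 eps u0
                         (fun b i => z b i w) (fun j => coin j w) k in
  let u eps k w := iter_u (state eps k w) in
  (* v eps k is v_{k-1} *)
  let v eps k w := iter_v (state eps k w) in
  let residual eps k :=
    ('E_P[fun w => (dot_norm dot (F (u eps k w)) ^+ 2
      + 2 * L ^+ 2 * dot_norm dot (u eps k w - v eps k w) ^+ 2)%R])%E in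
  let queries eps k w := halpern_queries dot Fhat sigma L eta0 eps u0
                           (fun b i => z b i w) (fun j => coin j w) k in
  let N eps := ceiln (Num.sqrt Lambda0 / (Num.sqrt Lambda1 * eps)) in
  [/\ forall eps : R, 0 < eps -> forall k : nat, (2 <= k)%N ->
        (residual eps k <=
           (Lambda0 / (k.+1%:R * k.+2%:R) + Lambda1 * eps ^+ 2)%:E)%E,
      forall eps : R, 0 < eps ->
        (residual eps (N eps) <= (2 * Lambda1 * eps ^+ 2)%:E)%E
    & u0 <> ustar ->
      \forall eps \near (0 : R)^'+,
        [/\ 2 * Lambda1 * eps ^+ 2 <= C (L * eta0) * eps ^+ 2,
            (N eps)%:R <= C (L * eta0) * (L * dist / eps)
          & ('E_P[fun w => ((queries eps (N eps) w)%:R : R)] <=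
              (C (L * eta0) *
                ((sigma ^+ 2 * L * dist + L ^+ 3 * dist ^+ 3)
                   / eps ^+ 3))%:E)%E]].
Proof.
exists (@hidden_const R) => d dot F sigma L e0 u0 us dZ Z Pz Fhat dO Omega P z coin
  sigma0 L0 Fmono Flip oracle Fus e00 e0L rnd M eta_ dist Lambda0 Lambda1
  state u v residual queries N.
have Me : 9 * L ^+ 2 * e0 ^+ 2 <= 1 / 3.
  have s3 : 0 < 3 * Num.sqrt 3 * L by rewrite !mulr_gt0 ?sqrtr_gt0.
  move: e0L; rewrite ler_pdivlMr// => e0L.
  have : (e0 * (3 * Num.sqrt 3 * L)) ^+ 2 <= 1.
    by rewrite exprn_ile1// mulr_ge0// ltW.
  by rewrite !exprMn sqr_sqrtr//; lra.
have residual_le eps k : 0 < eps ->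
    (residual eps k <=
      (Lambda0 / (k.+1%:R * k.+2%:R) + Lambda1 * eps ^+ 2)%:E)%E.
  move=> ep.
  have := mean_residual u0 L0 ep Fmono Flip oracle Fus e00 Me rnd k.
  move=> /mean_le_expectation H.
  rewrite /residual /Lambda0 /dist sqr_dot_norm.
  under eq_fun do rewrite !sqr_dot_norm.
  apply: H => w; rewrite addr_ge0 ?dot_ge0// mulr_ge0 ?dot_ge0//.
  by rewrite mulr_ge0 ?sqr_ge0.
have L1 : Lambda1 = scaled_Lambda1 (L * e0) by exact: Lambda1E.
have L00 : Lambda0 = scaled_Lambda0 (L * e0) * (L * dist) ^+ 2 by exact: Lambda0E.
have l0 := scaled_Lambda0_gt0 L0 e00 Me; have l1 := scaled_Lambda1_gt0 L0 e00 Me.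
have c2 := iteration_const_ge2 L e0.
have cq := query_const_ge0 L0 e00 Me.
split=> [eps ep k _|eps ep|uus]; first exact: residual_le.
  apply: le_trans (residual_le _ _ ep) _; rewrite lee_fin.
  rewrite (_ : 2 * Lambda1 = Lambda1 + Lambda1); last by ring.
  rewrite mulrDl lerD2r; apply: iterations_suffice => //.
    by rewrite L00 mulr_ge0 ?sqr_ge0// ltW.
  by rewrite L1.
have dist0 : 0 < dist.
  rewrite lt_def sqrtr_ge0 andbT; apply/eqP => d0; apply/uus/subr0_eq/(@dot_eq0 _ _ dot).
  by rewrite -sqr_dot_norm -/dist d0 expr0n.
have D0 : 0 < L * dist by rewrite mulr_gt0.
near=> eps.
have ep : 0 < eps by near: eps; exact: nbhs_right_gt.
have eD : eps <= L * dist by near: eps; exact: nbhs_right_le.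
have X1 : 1 <= L * dist / eps by rewrite ler_pdivlMr// mul1r.
have N1 : (N eps).+1%:R <= iteration_const (L * e0) * (L * dist / eps).
  by rewrite /N L00 L1; exact: iterations_le.
split.
- by rewrite L1 ler_wpM2r ?sqr_ge0// /hidden_const; lra.
- apply: (@le_trans _ _ (N eps).+1%:R); first by rewrite ler_nat.
  apply: le_trans N1 _; rewrite ler_wpM2r//; first by lra.
  by rewrite /hidden_const; lra.
pose g := Ft_const (L * e0) * (L * dist) ^+ 2.
have gE : 3 * Lambda0 + 3 * Lambda1 * eps ^+ 2 * (N eps).+1%:R ^+ 2
    + 6 * eps ^+ 2 * (N eps).+1%:R ^+ 2 <= g.
  have Ne : eps ^+ 2 * (N eps).+1%:R ^+ 2
      <= iteration_const (L * e0) ^+ 2 * (L * dist) ^+ 2.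
    rewrite -!exprMn lerXn2r ?nnegrE//.
    - by rewrite mulr_ge0// ltW.
    - by rewrite mulr_ge0 ?(ltW D0)//; lra.
    - by rewrite mulrC -ler_pdivlMr// -mulrA.
  rewrite L00 L1 /g /Ft_const.
  move: (scaled_Lambda0 _) (scaled_Lambda1 _) (iteration_const _) l1 Ne => a b c b0 Ne.
  have := ler_wpM2l (_ : 0 <= 3 * b + 6) Ne.
  by move=> /(_ (addr_ge0 (mulr_ge0 (ler0n _ 3) (ltW b0)) (ler0n _ 6))); lra.
have gE' : 3 * (4 * (L ^+ 2 * e0 * eta_lim L e0 + 1) * dot (u0 - us) (u0 - us)
      / eta_lim L e0 ^+ 2)
    + 3 * Lambda1 * eps ^+ 2 * (N eps).+1%:R ^+ 2
    + 6 * eps ^+ 2 * (N eps).+1%:R ^+ 2 <= g.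
  by move: gE; rewrite /Lambda0 /dist sqr_dot_norm.
have := mean_queries L0 ep Fmono Flip oracle Fus e00 Me rnd gE'.
move=> /mean_le_expectation Q; apply: le_trans (Q _) _ => //.
rewrite lee_fin.
set q := 8 * sigma ^+ 2 / eps ^+ 2 + 3 + _.
have cF := Ft_const_ge0 L0 e00 Me.
have k0 : 0 <= 48 * (2 * (L * e0) ^+ 2 + 1 / 2) :> R.
  by rewrite mulr_ge0// addr_ge0// pmulr_rge0 ?sqr_ge0.
have q0 : 0 <= q.
  rewrite /q addr_ge0//; last first.
    by rewrite divr_ge0 ?sqr_ge0// mulr_ge0// mulr_ge0 ?sqr_ge0.
  by rewrite addr_ge0// divr_ge0 ?sqr_ge0// pmulr_rge0 ?sqr_ge0.
apply: le_trans (ler_wpM2r q0 N1) _.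
have sL : sigma ^+ 2 * L * dist + L ^+ 3 * dist ^+ 3
   = sigma ^+ 2 * (L * dist) + (L * dist) ^+ 3 by ring.
rewrite sL.
apply: (@le_trans _ _ (query_const (L * e0)
   * ((sigma ^+ 2 * (L * dist) + (L * dist) ^+ 3) / eps ^+ 3))); last first.
  rewrite ler_wpM2r ?divr_ge0 ?exprn_ge0 ?(ltW ep)//.
    by rewrite addr_ge0 ?exprn_ge0 ?(ltW D0)// mulr_ge0 ?sqr_ge0 ?(ltW D0).
  by rewrite /hidden_const; lra.
pose X := L * dist / eps; pose s := sigma ^+ 2 / eps ^+ 2.
have s0 : 0 <= s by rewrite divr_ge0 ?sqr_ge0.
rewrite /query_const.
set K := 48 * (2 * (L * e0) ^+ 2 + 1 / 2) in k0 *.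
have -> : q = 8 * s + 3 + K * Ft_const (L * e0) * X ^+ 2.
  by rewrite /q /s /g /X -/K; field; rewrite gt_eqF.
have -> : (sigma ^+ 2 * (L * dist) + (L * dist) ^+ 3) / eps ^+ 3 = s * X + X ^+ 3.
  by rewrite /s /X; field; rewrite gt_eqF.
rewrite -/X -!(mulrA (iteration_const _)) ler_pM2l; last by lra.
have {}X1 : 1 <= X by [].
have := mulr_ge0 k0 cF; move: (K * _) (X) X1 => c x x1 c0.
have xs : 0 <= s * x by rewrite mulr_ge0//; lra.
have x3 : x <= x ^+ 3 by rewrite exprS ler_peMr ?exprn_ege1//; lra.
have := mulr_ge0 c0 xs; rewrite exprS in x3 *; lra.
Unshelve. all: by end_near.
Qed.
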